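(* Let $\mathcal{K}$ be a non-archimedean locally compact field with finite residue field of order $q$, let $G$ be an almost simple linear algebraic group over $\mathcal{K}$ of $\mathcal{K}$-rank $\ell+1$, and let $\mathfrak{T}$ be the Bruhat-Tits building associated with $G(\mathcal{K})$, a simplicial complex of dimension $\ell+1$. Let $X$ be the link of a vertex of $\mathfrak{T}$ (a finite simplicial complex of dimension $\ell$). For every integer $i$ with $0\leq i\leq \ell-1$, let $M^i(X)$ be the maximal eigenvalue and $m^i(X)$ the minimal non-zero eigenvalue of the Laplace operator $\Delta=\delta d$ acting on $C^i(X)$. Then $$M^i(X)=\ell+1\quad\text{and}\quad m^i(X)\leq \ell-i.$$
   Context: A simplicial complex is a collection of finite nonempty sets (simplices) closed under taking nonempty subsets; a simplex $s$ has dimension $|s|-1$. The link $\mathrm{Lk}(v)$ of a vertex $v$ consists of the simplices $t$ with $v\notin t$ and $t\cup\{v\}$ a simplex. Let $X$ be a finite simplicial complex of dimension $n$ in which every simplex is a face of some $n$-simplex (this holds, with $n=\ell$, for the link in the claim). $\mathrm{Ver}(X)$ is the set of vertices and $S_i(X)$ is the set of oriented $i$-simplices ($i$-simplices with an ordering of the vertices up to even permutation); $\bar s$ is $s$ with the opposite orientation. $C^i(X)$ is the real vector space of functions $f:S_i(X)\to\mathbb{R}$ with $f(\bar s)=-f(s)$ (no condition if $i=0$), and $C^i(X)=0$ for $i<0$ or $i>n$. For a simplex $s$, $w(s)$ is the number of (non-oriented) $n$-simplices of $X$ containing $s$. The coboundary $d:C^i(X)\to C^{i+1}(X)$ is $(df)([v_0,\dots,v_{i+1}])=\sum_{j=0}^{i+1}(-1)^jf([v_0,\dots,\hat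 v_j,\dots,v_{i+1}])$. The map $\delta:C^{i+1}(X)\to C^{i}(X)$ is $(\delta f)(s)=\sum_{v}\frac{w([v,s])}{w(s)}f([v,s])$, the sum being over $v\in\mathrm{Ver}(X)$ such that $\{v\}\cup s$ is an $(i+1)$-simplex, where for $s=[v_0,\dots,v_i]$ one puts $[v,s]=[v,v_0,\dots,v_i]$. The Laplace operator on $C^i(X)$ is $\Delta=\delta d$. It is self-adjoint and positive semi-definite for the inner product $(f,g)=\sum_{s}w(s)f(s)g(s)$ (sum over non-oriented $i$-simplices, each with an arbitrary orientation), so it is diagonalizable with non-negative real eigenvalues. *)

(* Defs.v *)
From HB Require Import structures.
From mathcomp Require Import all_boot all_order all_fingroup all_algebra.
From mathcomp Require Import finmap.
From mathcomp Require Import all_classical all_reals all_analysis.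
From mathcomp Require mpoly.
Import (canonicals) mpoly.

Set Implicit Arguments.
Unset Strict Implicit.
Unset Printing Implicit Defensive.

Import Order.TTheory GRing.Theory Num.Theory.

Local Open Scope classical_set_scope.
Local Open Scope ring_scope.

(** * Simplicial complexes and the weighted Laplace operator *)

Section Complexes.
Variable V : choiceType.

(* A complex is given by the set of its simplices, and its vertices are the [v]
   such that [[fset v]] is a simplex. *)
Definition link (X : set {fset V}) (v : V) : set {fset V} :=
  [set t | [/\ t != fset0, v \notin t & X (v |` t)%fset]].

(* The dimension of a finite complex.  [fset_set X] is [fset0] when [X] is
   infinite, so this and [weight] are meaningful for finite complexes only. *)
Definition dimension (X : set {fset V}) : nat :=
  \max_(s <- fset_set X) (#|` s|).-1.

Definition weight (X : set {fset V}) (s : {fset V}) : nat :=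
  #|` fset_set [set t | [/\ X t, #|` t| = (dimension X).+1 & (s `<=` t)%fset]]|.

(* An ordering of the vertices of an [i]-simplex of [X]. *)
Definition ordered_simplex (X : set {fset V}) (i : nat) (s : i.+1.-tuple V) :
  Prop := uniq s /\ X [fset x in val s]%fset.

Definition reorder (i : nat) (s : i.+1.-tuple V) (p : 'S_i.+1) :
  i.+1.-tuple V := [tuple tnth s (p k) | k < i.+1].

Definition omit (i : nat) (s : i.+2.-tuple V) (j : 'I_i.+2) : i.+1.-tuple V :=
  [tuple tnth s (lift j k) | k < i.+1].

Variable R : realType.

(* [C^i(X)].  An oriented simplex is an ordering of the vertices up to even
   permutations, so a function [f] of oriented simplices with
   [f (opposite s) = - f s] is a function of orderings which is multiplied by
   the signature when the vertices are reordered; this is no condition for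
   [i = 0].  Cochains are extended by [0] to the tuples which are not orderings
   of an [i]-simplex, so that the cochains of [X] are compared by [=]. *)
Definition cochain (X : set {fset V}) (i : nat) :
    set (i.+1.-tuple V -> R) :=
  [set f | (forall s, ~ ordered_simplex X s -> f s = 0) /\
           (forall s (p : 'S_i.+1), f (reorder s p) = (-1) ^+ p * f s)].

Definition coboundary (X : set {fset V}) (i : nat) (f : i.+1.-tuple V -> R) :
    i.+2.-tuple V -> R :=
  fun s => if `[< ordered_simplex X s >]
           then \sum_(j < i.+2) (-1) ^+ j * f (omit s j) else 0.

Definition codifferential (X : set {fset V}) (i : nat)
    (f : i.+2.-tuple V -> R) : i.+1.-tuple V -> R :=
  fun s => \sum_(v \in [set v | ordered_simplex X [tuple of v :: s]])
    (weight X [fset x in v :: val s]%fset)%:R / (weight X [fset x in val s]%fset)%:R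
      * f [tuple of v :: s].

Definition laplace (X : set {fset V}) (i : nat) (f : i.+1.-tuple V -> R) :
  i.+1.-tuple V -> R := codifferential X (coboundary X f).

Definition laplace_eigenvalue (X : set {fset V}) (i : nat) (a : R) : Prop :=
  exists f : i.+1.-tuple V -> R,
    [/\ cochain X f, f <> (fun=> 0) & laplace X f = (fun s => a * f s)].

Definition max_eigenvalue (X : set {fset V}) (i : nat) (M : R) : Prop :=
  laplace_eigenvalue X i M /\
  forall a, laplace_eigenvalue X i a -> a <= M.

Definition min_nonzero_eigenvalue (X : set {fset V}) (i : nat) (m : R) :
    Prop :=
  [/\ laplace_eigenvalue X i m, m != 0 &
      forall a, laplace_eigenvalue X i a -> a != 0 -> m <= a].

End Complexes.

(** * Non-archimedean locally compact fields *)

HB.structure Definition TopologicalField :=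
  {K of Topological K & GRing.Field K}.

(* [nu] is a non-trivial non-archimedean absolute value which induces the
   topology of [K]. *)
Definition nonarchimedean_abs (K : TopologicalField.type) (R : realType)
    (nu : K -> R) : Prop :=
  [/\ [/\ forall x, 0 <= nu x,
          forall x, nu x = 0 <-> x = 0,
          forall x y, nu (x * y) = nu x * nu y
        & forall x y, nu (x + y) <= Num.max (nu x) (nu y)],
      exists2 x, x != 0 & nu x != 1
    & forall (x : K) (A : set K), nbhs x A <->
        exists2 e : R, 0 < e & forall y, nu (y - x) < e -> A y].

(* The residue field [{nu <= 1} / {nu < 1}] has exactly [q] elements. *)
Definition residue_order (K : fieldType) (R : realType) (nu : K -> R)
    (q : nat) : Prop :=
  exists e : 'I_q -> K, (forall j, nu (e j) <= 1) /\
    forall x, nu x <= 1 -> exists! j, nu (x - e j) < 1.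

(** * Groups of matrices *)

Section MatrixGroups.
Variables (F : fieldType) (N : nat).
Implicit Types (A B H : set 'M[F]_N) (g : 'M[F]_N).

Definition is_subgroup H : Prop :=
  [/\ H `<=` [set g | g \in unitmx],
      H 1%:M,
      forall g h, H g -> H h -> H (g *m h)
    & forall g, H g -> H (invmx g)].

Definition generated A : set 'M[F]_N :=
  [set g | forall H, is_subgroup H -> A `<=` H -> H g].

Definition normalizes g A : Prop := [set g *m a *m invmx g | a in A] = A.

Definition left_coset g A : set 'M[F]_N := [set g *m a | a in A].

Definition double_coset B g : set 'M[F]_N :=
  [set h | exists b c, [/\ B b, B c & h = b *m g *m c]].

Definition derived H : set 'M[F]_N :=
  generated [set x | exists g h, [/\ H g, H h &
                       x = g *m h *m invmx g *m invmx h]].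

Definition solvable H : Prop :=
  exists n, iter n derived H `<=` [set 1%:M].

(* [h * diag(chi_1(t), ..., chi_N(t)) * h^-1], where
   [chi_i(t) = \prod_k t_k ^ (a i k)]. *)
Definition torus_elt (r : nat) (h : 'M[F]_N) (a : 'M[int]_(N, r))
    (t : 'rV[F]_r) : 'M[F]_N :=
  h *m diag_mx (\row_i \prod_k (t 0 k) ^ (a i k)) *m invmx h.

End MatrixGroups.

(** * Linear algebraic groups *)

Section AlgebraicGroups.
Variables (K : fieldType) (L : closedFieldType) (iota : {rmorphism K -> L}).
Variable N : nat.
Implicit Types (X Y G H : set 'M[L]_N).

(* The value at a matrix of a polynomial in its [N * N] entries. *)
Definition eval_poly (p : mpoly.mpoly (N * N) L) (x : 'M[L]_N) : L :=
  mpoly.meval (fun k => mxvec x 0 k) p.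

Definition vanishes_on X (p : mpoly.mpoly (N * N) L) : Prop :=
  forall x, X x -> eval_poly p x = 0.

(* Zariski-closed subsets of [GL_N].  Polynomials in the entries suffice: a
   power of the determinant can be cleared from any denominator. *)
Definition zariski_closed X : Prop :=
  exists E : set (mpoly.mpoly (N * N) L),
    X = [set x | x \in unitmx /\ forall p, E p -> eval_poly p x = 0].

Definition zariski_connected X : Prop :=
  forall Y Z, zariski_closed Y -> zariski_closed Z ->
    X `<=` Y `|` Z -> X `&` Y `&` Z = set0 -> X `<=` Y \/ X `<=` Z.

(* The ideal of [X] is generated by polynomials with coefficients in [K].  Since
   the polynomials over [K] in that ideal are an ideal of [K[x_ij]], this says
   that they span it over [L]. *)
Definition defined_over X : Prop :=
  forall p, vanishes_on X p ->
  exists (n : nat) (c : 'I_n -> L) (u : 'I_n -> mpoly.mpoly (N * N) K),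
    (forall j, vanishes_on X (mpoly.map_mpoly iota (u j))) /\
    p = \sum_(j < n) c j *: mpoly.map_mpoly iota (u j).

Definition algebraic_group G : Prop := is_subgroup G /\ zariski_closed G.

Definition normal_subgroup H G : Prop :=
  H `<=` G /\ forall g, G g -> normalizes g H.

Definition semisimple G : Prop :=
  [/\ algebraic_group G, zariski_connected G &
      forall H, algebraic_group H -> zariski_connected H ->
        normal_subgroup H G -> solvable H -> H = [set 1%:M]].

(* Almost simple over [K]: a non-trivial connected semisimple [K]-group without
   proper non-trivial connected normal [K]-subgroup. *)
Definition almost_simple G : Prop :=
  [/\ semisimple G, defined_over G, G <> [set 1%:M] &
      forall H, algebraic_group H -> defined_over H -> zariski_connected H ->
        normal_subgroup H G -> H = [set 1%:M] \/ H = G].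

Definition rational_points G : set 'M[K]_N :=
  [set g | G (map_mx iota g)].

(* The [L]-points of the [K]-split torus with parameters [h] and [a]. *)
Definition torus (r : nat) (h : 'M[K]_N) (a : 'M[int]_(N, r)) :
    set 'M[L]_N :=
  [set torus_elt (map_mx iota h) a t
    | t in [set t : 'rV[L]_r | forall k, t 0 k != 0]].

(* A [K]-split torus of [G] of dimension [r], with an isomorphism from
   [GL_1 ^ r]: a representation of [GL_1 ^ r] over [K] is diagonalizable over
   [K], and it is a closed immersion if and only if its weights, the rows of
   [a], generate [Z ^ r]. *)
Definition split_torus G (r : nat) (h : 'M[K]_N) (a : 'M[int]_(N, r)) :
    Prop :=
  [/\ h \in unitmx, exists b : 'M[int]_(r, N), b *m a = 1%:M
    & torus h a `<=` G].

Definition has_rank G (r : nat) : Prop :=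
  (exists h a, split_torus (r := r) G h a) /\
  forall r' h a, split_torus (r := r') G h a -> (r' <= r)%N.

(* The group usually denoted [G(K)^+], generated by the [K]-points of the
   unipotent radicals of the parabolic [K]-subgroups of the connected reductive
   group [G].  These radicals are the groups [U(lambda)] of the [g] such that
   [lambda(t) g lambda(t)^-1] tends to [1] when [t] tends to [0], for the
   cocharacters [lambda : t |-> h diag(t ^ a_1, ..., t ^ a_N) h^-1] of [G]
   over [K]; the entry [(i, j)] of [h^-1 g h] is multiplied by
   [t ^ (a_i - a_j)]. *)
Definition unipotent_radical_points G (h : 'M[K]_N) (a : 'M[int]_(N, 1)) :
    set 'M[K]_N :=
  [set g | rational_points G g /\
     forall i j, a i 0 <= a j 0 ->
       (invmx h *m g *m h) i j = (i == j)%:R].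

Definition Gplus G : set 'M[K]_N :=
  generated [set g | exists (h : 'M[K]_N) (a : 'M[int]_(N, 1)),
    [/\ h \in unitmx, torus h a `<=` G & unipotent_radical_points G h a g]].

End AlgebraicGroups.

(** * The Bruhat-Tits building *)

Section BruhatTits.
Variables (R : realType) (K : TopologicalField.type) (nu : K -> R).
Variables (L : closedFieldType) (iota : {rmorphism K -> L}) (N : nat).
Variables (G : set 'M[L]_N) (r : nat).

(* The affine Tits system of Bruhat and Tits, for [G] of [K]-rank [r].  The
   group is [G(K)^+], which is [G(K)] for [G] simply connected and in general
   the image of the rational points of the simply connected cover of [G]; they
   have the same building.

   [bt_S] is a maximal [K]-split torus [S], and [bt_N] is the normalizer of [S]
   in [G(K)^+].  The group [bt_N] acts on the apartment, an affine space under
   [V = X_*(S) (x) R], which the coordinates [bt_a] identify with [R ^ r].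
   Elements [s] of [S(K)] act as the translations by the [v] such that
   [chi(v) = - omega(chi(s))] for all characters [chi] of [S], where
   [omega = - ln nu].  Through this action the quotient by [bt_B :&: bt_N] is
   the affine Weyl group, discrete and generated by the reflections [bt_s j] in
   the walls of an alcove, the open simplex with the vertices [bt_x k].  The
   Iwahori subgroup [bt_B] is the stabilizer of that alcove.

   The Tits system determines the valuated root datum of [(G, S)], so that it
   is unique up to conjugation, and the choices do not affect the building. *)
Record bruhat_tits_system : Type := BruhatTitsSystem {
  bt_h : 'M[K]_N;
  bt_a : 'M[int]_(N, r);
  bt_B : set 'M[K]_N;
  bt_s : 'I_r.+1 -> 'M[K]_N;
  bt_act : 'M[K]_N -> 'rV[R]_r -> 'rV[R]_r;
  bt_x : 'I_r.+1 -> 'rV[R]_r;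

  bt_S := torus iota bt_h bt_a;
  bt_N := Gplus iota G `&` [set g | normalizes (map_mx iota g) bt_S];
  bt_alcove := [set y | exists c : 'I_r.+1 -> R,
    [/\ forall k, 0 < c k, \sum_k c k = 1 & y = \sum_k c k *: bt_x k]];

  bt_S_split : split_torus iota G bt_h bt_a;

  (* [bt_B] is a compact open subgroup of [G(K)^+] *)
  bt_B_group : is_subgroup bt_B;
  bt_B_sub : bt_B `<=` Gplus iota G;
  bt_B_open : exists2 U : set 'M[K]_N, open U & bt_B = Gplus iota G `&` U;
  bt_B_compact : compact bt_B;

  (* the axioms of a Tits system; the [bt_s j] represent its generators *)
  bt_generated : generated (bt_B `|` bt_N) = Gplus iota G;
  bt_normal : forall g, bt_N g -> normalizes g (bt_B `&` bt_N);
  bt_s_N : forall j, bt_N (bt_s j);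
  bt_s_order2 : forall j, ~ bt_B (bt_s j) /\ bt_B (bt_s j *m bt_s j);
  bt_s_generate : generated (range bt_s `|` (bt_B `&` bt_N)) = bt_N;
  bt_exchange : forall j g b, bt_N g -> bt_B b ->
    double_coset bt_B g (bt_s j *m b *m g) \/
    double_coset bt_B (bt_s j *m g) (bt_s j *m b *m g);
  bt_thick : forall j, exists2 b, bt_B b &
    ~ bt_B (bt_s j *m b *m invmx (bt_s j));

  (* the apartment, with its action of the affine Weyl group *)
  bt_act_affine : forall g, bt_N g ->
    exists (A : 'M[R]_r) (c : 'rV[R]_r), forall y, bt_act g y = y *m A + c;
  bt_act_mul : forall g h y, bt_N g -> bt_N h ->
    bt_act (g *m h) y = bt_act g (bt_act h y);
  bt_act_translation : forall t : 'rV[K]_r, (forall k, t 0 k != 0) ->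
    bt_N (torus_elt bt_h bt_a t) ->
    forall y, bt_act (torus_elt bt_h bt_a t) y
              = y + \row_k ln (nu (t 0 k));
  bt_act_ker : forall g, bt_N g -> bt_B g -> forall y, bt_act g y = y;
  bt_act_discrete : forall (y : 'rV[R]_r) (M : R),
    finite_set [set bt_act g
      | g in bt_N `&` [set g | forall k, `|bt_act g y 0 k| <= M]];
  bt_x_indep : forall c : 'I_r.+1 -> R,
    \sum_k c k = 0 -> \sum_k c k *: bt_x k = 0 -> forall k, c k = 0;
  bt_s_reflection : forall j k, k != j -> bt_act (bt_s j) (bt_x k) = bt_x k;
  bt_act_alcove : forall g y, bt_N g -> bt_alcove y ->
    bt_alcove (bt_act g y) -> bt_B g
}.

(* The standard parahoric subgroup of type [J]. *)
Definition parahoric (D : bruhat_tits_system) (J : {set 'I_r.+1}) :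
    set 'M[K]_N :=
  generated (bt_B D `|` [set bt_s D j | j in [set j | j \in J]]).

(* The building of the Tits system.  Its vertices are the cosets of the maximal
   standard parahoric subgroups, and the facets of the chamber [g B] are the
   non-empty subsets of the set of the [r + 1] vertices containing [g]. *)
Definition building (D : bruhat_tits_system) : set {fset set 'M[K]_N} :=
  [set s | exists (g : 'M[K]_N) (J : {set 'I_r.+1}),
    [/\ Gplus iota G g, J != finset.set0 &
        s = [fset left_coset g (parahoric D (~: [set j])%SET) | j in J]%fset]].

End BruhatTits.

(* Main.v *)
(* Write N = l + 1 for the number of types of vertices of X.  On an ordered
   simplex s, the Laplacian is the average over the chambers sg containing s of
     N f(s) - sum_j (-1)^j sum_{u in sg} f(u, s_0, .., s_j omitted, .., s_i),
   so that (Delta f, f) is N (f, f) minus a sum of squares, and N is attained by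
   the cochains, pulled back from the simplex of types, that have zero sums
   over the vertices of each chamber.

   A cochain f supported on the simplices of a single type J satisfies
   (Delta f, f) = (l - i) (f, f).  If moreover f is orthogonal to the kernel of d,
   the spectral theorem gives a non-zero eigenvalue at most l - i.  To find f,
   let the finite Weyl group W_J act on the face of type J of a chamber of X: the
   alternating sum of the images is a cycle, and as W_J fixes the other vertices
   of the chamber, the cycle is a cone boundary.  Hence pairing with it kills all
   cocycles, and f is the cochain representing this pairing.

   The properties of X used here (types, finiteness, and that an element of W_J
   fixing the face fixes the chamber) come from the Bruhat decomposition and the
   action of the affine Weyl group on the alcove. *)
Require Import Defs.
From HB Require Import structures.
From mathcomp Require Import all_boot all_order all_fingroup all_algebra.
From mathcomp Require Import complex ring.
From mathcomp Require Import finmap.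
From mathcomp Require Import all_classical all_reals all_analysis.

Set Implicit Arguments.
Unset Strict Implicit.
Unset Printing Implicit Defensive.

Import Order.TTheory GRing.Theory Num.Theory.

Local Open Scope ring_scope.


(** * Symmetric matrices *)

Local Open Scope sesquilinear_scope.

(** Cochains are treated as alternating functions of all tuples of vertices, repetitions included.
    Alternation makes them vanish on tuples with repeated entries. In exchange, sums over a chamber
    range over all its N vertices, which is where the constant N comes from, and contraction becomes
    an exact adjoint of the coboundary on each chamber. Multiplying by the weight of s turns the
    quotients w([v,s])/w(s) into counts of chambers.

    The bound l - i is N - (i + 1): for a cochain of a single type, each of the i + 1 omitted
    entries of a simplex in its support can be restored in only one way inside a chamber. The
    hypothesis i < l serves both halves: the determinant that attains N uses i + 2 types, and the
    apex of the cone needs a type outside J.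

    The alternating sum needs signs for the elements of W_J. They are taken from determinants of the
    affine action on the apartment, so that no Coxeter presentation has to be established. *)

Section Spectral.
Variables (R : rcfType) (m : nat) (S : 'M[R]_m).
Hypothesis S_sym : S^T = S.

Local Notation C := R[i].
Local Notation toC := (map_mx (real_complex R)).

Lemma mul_map_real_complex n (p : 'rV[C]_m) (B : 'M[R]_(m, n)) :
  map_mx (@complex.Re R) (p *m toC B) = map_mx (@complex.Re R) p *m B /\
  map_mx (@complex.Im R) (p *m toC B) = map_mx (@complex.Im R) p *m B.
Proof.
split; apply/rowP => j; rewrite !mxE.
  rewrite (big_morph (@complex.Re R) (id1 := 0) (op1 := +%R)) //; last by case=> ? ? [].
  by apply: eq_bigr => k _; rewrite !mxE; case: (p 0 k) => x y /=; rewrite mulr0 subr0.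
rewrite (big_morph (@complex.Im R) (id1 := 0) (op1 := +%R)) //; last by case=> ? ? [].
by apply: eq_bigr => k _; rewrite !mxE; case: (p 0 k) => x y /=; rewrite mulr0 add0r.
Qed.

Lemma row_complex_eq0 n (p : 'rV[C]_n) :
  map_mx (@complex.Re R) p = 0 -> map_mx (@complex.Im R) p = 0 -> p = 0.
Proof.
move=> hr hi; apply/rowP => j; move/rowP/(_ j): hr; move/rowP/(_ j): hi.
by rewrite !mxE; case: (p 0 j) => x y /= -> ->.
Qed.

(** As [S] and [a] are real, the real and imaginary parts of [p] satisfy the same equation, and one
    of them is non-zero. *)
Lemma real_eigenvector (p : 'rV[C]_m) (a : R) :
  p != 0 -> p *m toC S = (real_complex R a) *: p ->
  exists2 u : 'rV[R]_m, u != 0 & u *m S = a *: u.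
Proof.
move=> p0 hp; have [hr hi] := mul_map_real_complex p S.
have [hr' hi'] : map_mx (@complex.Re R) (p *m toC S) = a *: map_mx (@complex.Re R) p
   /\ map_mx (@complex.Im R) (p *m toC S) = a *: map_mx (@complex.Im R) p.
  rewrite hp; split; apply/rowP => j; rewrite !mxE; case: (p 0 j) => x y /=.
    by rewrite mul0r subr0.
  by rewrite mul0r addr0.
case: (eqVneq (map_mx (@complex.Re R) p) 0) => [r0|r0]; last first.
  by exists (map_mx (@complex.Re R) p); rewrite // -hr.
case: (eqVneq (map_mx (@complex.Im R) p) 0) => [i0|i0]; last first.
  by exists (map_mx (@complex.Im R) p); rewrite // -hi.
by case/eqP: p0; apply: row_complex_eq0.
Qed.

(** For the last clause, let [w] be the coordinates of [v] in a complex orthonormal eigenbasis. Then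
    [v S v^T - c v v^T] is the sum of the [(sp k - c) |w_k|^2], where [w_k = 0] whenever [sp k = 0].
    If every non-zero [sp k] exceeded [c], this would be positive. *)
Lemma real_symmetric_spectrum : exists sp : 'I_m -> R,
  [/\ forall k, exists2 u : 'rV[R]_m, u != 0 & u *m S = sp k *: u,
      forall a (u : 'rV[R]_m), u != 0 -> u *m S = a *: u -> exists k, a = sp k &
      forall (c : R) (v : 'rV[R]_m), v != 0 ->
        (forall u : 'rV[R]_m, u *m S = 0 -> u *m v^T = 0) ->
        (v *m S *m v^T) 0 0 <= c * (v *m v^T) 0 0 ->
        exists2 k, sp k != 0 & sp k <= c].
Proof.
pose A := toC S.
have Areal : A \is a realmx.
  by apply/mxOverP => i j; rewrite mxE; apply/complex_realP; exists (S i j).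
have Aherm : A \is hermsymmx.
  apply: realsym_hermsym => //.
  apply/is_hermitianmxP; rewrite expr0 scale1r map_mx_id //.
  by rewrite /A map_trmx S_sym.
have Adiag := orthomx_spectralP (hermitian_normalmx Aherm).
have spreal := hermitian_spectral_diag_real Aherm.
set P := spectralmx A in Adiag; set D := spectral_diag A in Adiag spreal.
have Pu : P \in unitmx by exact: spectral_unit.
have invP : invmx P = P^t* by rewrite invmx_unitary ?spectral_unitarymx.
pose sp k := complex.Re (D 0 k).
have spE k : D 0 k = real_complex R (sp k).
  by rewrite /sp; have /mxOverP/(_ 0 k)/complex_realP[y ->] := spreal.
have rowP_eig k : row k P *m A = real_complex R (sp k) *: row k P.
  rewrite Adiag mulmxA mulmxA -row_mul mulmxV // row1 -rowE row_diag_mx.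
  by rewrite -scalemxAl -rowE spE.
have rowP_neq0 k : row k P != 0.
  apply/eqP => r0; have := row_mul k P (invmx P).
  rewrite r0 mul0mx mulmxV // => /rowP/(_ k); rewrite !mxE eqxx => /eqP.
  by rewrite oner_eq0.
exists sp; split.
- by move=> k; apply: real_eigenvector (rowP_eig k).
- move=> a u u0 hu; have [w wE] : {w | w = toC u *m invmx P} by exists (toC u *m invmx P).
  have w0 : w != 0.
    apply/eqP => w0; move/eqP: u0; apply.
    have : toC u = 0 by rewrite -[toC u](mulmxKV Pu) -wE w0 mul0mx.
    by move=> h; apply/rowP => j; move/rowP/(_ j): h; rewrite !mxE => -[].
  have /rV0Pn [k wk] := w0; exists k.
  have : w *m diag_mx D = real_complex R a *: w.
    have -> : w *m diag_mx D = toC u *m A *m invmx P.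
      by rewrite wE Adiag !mulmxA mulmxK.
    by rewrite -map_mxM hu map_mxZ wE scalemxAl.
  move=> /rowP/(_ k); rewrite mul_mx_diag !mxE spE [w 0 k * _]mulrC => e.
  by have /eqP := mulIf wk e; rewrite eq_sym => /eqP [].
- move=> c v v0 vker hv.
  have [w wP] : {w | w = toC v *m invmx P} by exists (toC v *m invmx P).
  have wE : toC v = w *m P by rewrite wP mulmxKV.
  have w0 : w != 0.
    apply/eqP => w0; move/eqP: v0; apply.
    have : toC v = 0 by rewrite wE w0 mul0mx.
    by move=> h; apply/rowP => j; move/rowP/(_ j): h; rewrite !mxE => -[].
  (* Up to conjugation, [w 0 k] is the product of row [k] of [P] with [v^T]. The real and imaginary
     parts of that row lie in the real kernel of [S], so [vker] applies to both. *)
  have wker k : sp k = 0 -> w 0 k = 0.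
    move=> spk; have hk := rowP_eig k.
    rewrite spk scale0r in hk.
    have [hr hi] := mul_map_real_complex (row k P) S.
    rewrite -/A hk !map_mx0 in hr hi.
    have {}hr := vker _ (esym hr); have {}hi := vker _ (esym hi).
    have [hr' hi'] := mul_map_real_complex (row k P) v^T.
    have : row k P *m toC v^T = 0.
      by apply: row_complex_eq0; rewrite ?hr' ?hi'.
    move=> /(congr1 (fun M => (M ^t*) 0 0)).
    rewrite trmx_mul map_mxM [in RHS]mxE [in RHS]mxE [in RHS]mxE rmorph0 => <-.
    have -> : (toC v^T) ^t* = toC v.
      rewrite -!map_trmx trmxK realmxC //.
      by apply/mxOverP => i j; rewrite mxE; apply/complex_realP; exists (v i j).
    by rewrite wP invP !mxE; apply: eq_bigr => j _; rewrite !mxE.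
  have [/existsP[k /andP[]]|] := boolP [exists k, (sp k != 0) && (sp k <= c)].
    by move=> ? ?; exists k.
  rewrite negb_exists => /forallP nk.
  have vvE (E : 'rV[C]_m) : (w *m diag_mx E *m w^t*) 0 0 =
      \sum_k E 0 k * (w 0 k * (w 0 k)^*).
    rewrite mxE; apply: eq_bigr => k _.
    by rewrite mul_mx_diag !mxE mulrAC mulrC.
  have vT : toC v^T = invmx P *m w^t*.
    have -> : toC v^T = (toC v)^t*.
      apply/matrixP => i j; rewrite !mxE; apply/esym/CrealP/complex_realP.
      by exists (v j i).
    by rewrite wE invP trmx_mul map_mxM.
  have e1 : real_complex R ((v *m S *m v^T) 0 0) = \sum_k D 0 k * (w 0 k * (w 0 k)^*).
    rewrite -vvE.
    have -> : w *m diag_mx D *m w^t* = toC (v *m S *m v^T).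
      by rewrite !map_mxM -/A vT Adiag wE !mulmxA !(mulmxK Pu).
    by rewrite [RHS]mxE.
  have e2 : real_complex R ((v *m v^T) 0 0) = \sum_k (w 0 k * (w 0 k)^*).
    have -> : \sum_k (w 0 k * (w 0 k)^*) = (w *m w^t*) 0 0.
      by rewrite mxE; apply: eq_bigr => k _; rewrite !mxE.
    have -> : w *m w^t* = toC (v *m v^T).
      by rewrite map_mxM vT wE mulmxA (mulmxK Pu).
    by rewrite [RHS]mxE.
  have : 0 < real_complex R ((v *m S *m v^T) 0 0 - c * (v *m v^T) 0 0).
    have -> x y : real_complex R (x - c * y) =
        real_complex R x - real_complex R c * real_complex R y.
      by rewrite rmorphB rmorphM.
    rewrite e1 e2 mulr_sumr -sumrB.
    have /rV0Pn [k wk] := w0.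
    have term j : w 0 j != 0 -> 0 < D 0 j * (w 0 j * (w 0 j)^*) -
         real_complex R c * (w 0 j * (w 0 j)^*).
      move=> wj; rewrite -mulrBl; apply: mulr_gt0; last by rewrite mul_conjC_gt0.
      have := nk j; rewrite negb_and negbK -ltNge => /orP[/eqP spj|cs].
        by rewrite (wker _ spj) eqxx in wj.
      by rewrite spE subr_gt0 ltcR.
    rewrite (bigD1 k) //=; apply: ltr_wpDr; last exact: term.
    apply: sumr_ge0 => j _; have [->|wj] := eqVneq (w 0 j) 0.
      by rewrite mul0r !mulr0 subr0.
    exact: ltW (term _ wj).
  by rewrite ltcR subr_gt0 ltNge hv.
Qed.
End Spectral.

Local Close Scope sesquilinear_scope.

(** * Eigenvalues of a symmetric form relative to positive weights *)

Section WeightedSpectrum.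
Variables (R : rcfType) (I : finType) (d : I -> R) (S : I -> I -> R).
Hypothesis d_gt0 : forall s, 0 < d s.
Hypothesis S_sym : forall s t, S s t = S t s.

Definition weighted_eigenvalue (a : R) :=
  exists2 u : I -> R, exists s, u s != 0 &
    forall t, \sum_s u s * S s t = a * d t * u t.

Let q s := Num.sqrt (d s).
Let q0 s : q s != 0. Proof. by rewrite gt_eqF // sqrtr_gt0. Qed.
Let qq s : q s * q s = d s. Proof. by rewrite -expr2 sqr_sqrtr // ltW. Qed.
Let M : 'M[R]_#|I| := \matrix_(i, j)
  (S (enum_val i) (enum_val j) / (q (enum_val i) * q (enum_val j))).
Let row_of (u : I -> R) : 'rV[R]_#|I| := \row_i (q (enum_val i) * u (enum_val i)).
Let fun_of (u : 'rV[R]_#|I|) (s : I) : R := u 0 (enum_rank s) / q s.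

Let sumE (F : I -> R) : \sum_(i < #|I|) F (enum_val i) = \sum_s F s.
Proof. by rewrite -(big_enum_val F). Qed.

Let fun_ofK u : row_of (fun_of u) = u.
Proof.
by apply/rowP => i; rewrite mxE /fun_of enum_valK mulrC mulfVK.
Qed.

Let row_ofM (u : I -> R) : row_of u *m M = \row_j
  ((\sum_s u s * S s (enum_val j)) / q (enum_val j)).
Proof.
apply/rowP => j; rewrite !mxE mulr_suml.
rewrite -sumE; apply: eq_bigr => i _; rewrite !mxE.
by field; rewrite !q0.
Qed.

Let row_of_neq0 u : (exists s, u s != 0) -> row_of u != 0.
Proof.
move=> [s us]; apply/eqP => /rowP/(_ (enum_rank s)).
by rewrite !mxE enum_rankK => /eqP; rewrite mulf_eq0 (negPf (q0 s)) (negPf us).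
Qed.

(** Scaling the coordinates by [q], the square root of [d], gives an ordinary eigenvalue problem for
    the symmetric matrix [M] and the standard product. The minimum exists because [sp] is a finite
    list of all the eigenvalues. *)
Lemma weighted_min_eigenvalue (c : R) (v : I -> R) :
  (exists s, v s != 0) ->
  (forall u, (forall t, \sum_s u s * S s t = 0) -> \sum_s d s * u s * v s = 0) ->
  \sum_t (\sum_s v s * S s t) * v t <= c * \sum_s d s * v s ^+ 2 ->
  exists m, [/\ weighted_eigenvalue m, m != 0, m <= c &
    forall a, weighted_eigenvalue a -> a != 0 -> m <= a].
Proof.
move=> v0 vker hv.
have Msym : M^T = M by apply/matrixP => i j; rewrite !mxE S_sym [q _ * _]mulrC.
have [sp [sp_eig eig_sp sp_min]] := real_symmetric_spectrum Msym.
have dotE u w : row_of u *m (row_of w)^T = (\sum_s d s * u s * w s)%:M.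
  apply/rowP => i; rewrite !ord1 !mxE eqxx mulr1n -sumE.
  by apply: eq_bigr => j _; rewrite !mxE mulrACA qq mulrA.
have eigP a : weighted_eigenvalue a <-> exists2 u : 'rV[R]_#|I|, u != 0 & u *m M = a *: u.
  split=> [[u u0 hu]|[u u0 hu]].
    exists (row_of u); first exact: row_of_neq0.
    rewrite row_ofM; apply/rowP => j; rewrite !mxE hu -qq.
    by field; rewrite !q0.
  exists (fun_of u).
    have /rV0Pn[i ui] := u0; exists (enum_val i).
    by rewrite /fun_of enum_valK mulf_neq0 // invr_neq0.
  move=> t; have := row_ofM (fun_of u); rewrite fun_ofK hu => /rowP/(_ (enum_rank t)).
  rewrite !mxE enum_rankK => /(congr1 ( *%R^~ (q t))); rewrite mulfVK // => <-.
  by rewrite /fun_of -qq; field; rewrite !q0.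
have [k0 spk0 spc] : exists2 k, sp k != 0 & sp k <= c.
  apply: (sp_min c (row_of v)); first exact: row_of_neq0.
    move=> u hu; rewrite -[u]fun_ofK dotE vker ?scalar_mx_is_zero ?raddf0 // => t.
    have := row_ofM (fun_of u); rewrite fun_ofK hu => /rowP/(_ (enum_rank t)).
    by rewrite !mxE enum_rankK => /(congr1 ( *%R^~ (q t))); rewrite mulfVK // mul0r.
  rewrite dotE.
  have -> : row_of v *m M *m (row_of v)^T = (\sum_t (\sum_s v s * S s t) * v t)%:M.
    rewrite row_ofM; apply/rowP => i; rewrite !ord1 !mxE eqxx mulr1n -sumE.
    by apply: eq_bigr => j _; rewrite !mxE mulrA mulfVK.
  rewrite !mxE eqxx !mulr1n; apply: le_trans hv _.
  rewrite le_eqVlt; apply/orP; left; apply/eqP; congr (_ * _).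
  by apply: eq_bigr => s _; rewrite mulrA.
case: (arg_minP sp (spk0 : (fun k => sp k != 0) k0)) => k /= spk kmin.
exists (sp k); split => //.
- by apply/eigP.
- exact: le_trans (kmin _ spk0) spc.
- by move=> a /eigP[u u0 /(eig_sp _ _ u0)[k' ->]]; exact: kmin.
Qed.
End WeightedSpectrum.

(** * Alternating functions of tuples *)

(** Unlike [omit], it applies to tuples of length 1 and then gives the empty tuple, as the
    contraction of a function of one vertex requires. *)
Definition omit_nth (T : Type) n (s : n.+1.-tuple T) (j : 'I_n.+1) : n.-tuple T :=
  [tuple tnth s (lift j k) | k < n].

Section Tuples.
Variable T : Type.

Lemma omit_cons0 n (u : T) (s : n.-tuple T) :
  omit_nth [tuple of u :: s] ord0 = s.
Proof. by apply: eq_from_tnth => k; rewrite tnth_mktuple tnthS. Qed.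

Lemma omit_cons_lift n (u : T) (s : n.+1.-tuple T) (j : 'I_n.+1) :
  omit_nth [tuple of u :: s] (lift ord0 j) = [tuple of u :: omit_nth s j].
Proof.
apply: eq_from_tnth => k; rewrite tnth_mktuple.
case: (unliftP ord0 k) => [k' ->|->].
  rewrite !tnthS tnth_mktuple.
  have -> : lift (lift ord0 j) (lift ord0 k') = lift ord0 (lift j k').
    by apply: val_inj; rewrite /= /bump !leq0n !add1n ltnS addnS.
  by rewrite tnthS.
by have -> : lift (lift ord0 j) ord0 = ord0 by apply: val_inj.
Qed.

End Tuples.

Lemma sum_tuple_cons (R : nmodType) (Y : finType) n (P : pred Y)
    (Q : pred (n.-tuple Y)) (G : n.+1.-tuple Y -> R) :
  \sum_(t : n.+1.-tuple Y | P (thead t) && Q (omit_nth t ord0)) G t =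
  \sum_(s | Q s) \sum_(u | P u) G [tuple of u :: s].
Proof.
rewrite exchange_big pair_big /=.
rewrite (reindex (fun us : Y * n.-tuple Y => [tuple of us.1 :: us.2])) /=.
  by apply: eq_bigl => -[u s] /=; rewrite omit_cons0 theadE.
exists (fun t : n.+1.-tuple Y => (thead t, omit_nth t ord0)).
  by move=> [u s] _ /=; rewrite omit_cons0.
move=> t _; apply: eq_from_tnth => k /=.
case: (unliftP ord0 k) => [k' ->|->]; first by rewrite tnthS tnth_mktuple.
by rewrite tnth0.
Qed.

Section Reorder.
Variable V : choiceType.

Lemma tnth_reorder i (s : i.+1.-tuple V) p k : tnth (reorder s p) k = tnth s (p k).
Proof. by rewrite tnth_mktuple. Qed.

Lemma reorderM i (s : i.+1.-tuple V) p q :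
  reorder (reorder s p) q = reorder s (q * p)%g.
Proof. by apply: eq_from_tnth => k; rewrite !tnth_reorder permM. Qed.

Lemma reorder1 i (s : i.+1.-tuple V) : reorder s 1%g = s.
Proof. by apply: eq_from_tnth => k; rewrite tnth_reorder perm1. Qed.

Lemma reorder_inj i p : injective (fun s : i.+1.-tuple V => reorder s p).
Proof.
by move=> s t /(congr1 (fun x => reorder x p^-1%g)); rewrite !reorderM mulVg !reorder1.
Qed.

Lemma mem_reorder i (s : i.+1.-tuple V) p : reorder s p =i s.
Proof.
move=> x; apply/tnthP/tnthP => -[k ->].
  by exists (p k); rewrite tnth_reorder.
by exists (p^-1%g k); rewrite tnth_reorder permKV.
Qed.

Lemma all_reorder i (s : i.+1.-tuple V) p a : all a (reorder s p) = all a s.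
Proof. exact/eq_all_r/mem_reorder. Qed.

End Reorder.

Definition alternating (R : pzRingType) (V : choiceType) i
    (f : i.+1.-tuple V -> R) :=
  forall s (p : 'S_i.+1), f (reorder s p) = (-1) ^+ p * f s.

Definition dsum (R : pzRingType) (V : choiceType) n (f : n.-tuple V -> R)
    (t : n.+1.-tuple V) : R :=
  \sum_(j < n.+1) (-1) ^+ j * f (omit_nth t j).

Section Alternating.
Variables (R : comPzRingType) (V : choiceType).

Lemma reorder_lift_perm n (t : n.+2.-tuple V) (j : 'I_n.+2) k q :
  omit_nth (reorder t (lift_perm j k q)) j = reorder (omit_nth t k) q.
Proof.
apply: eq_from_tnth => m.
by rewrite !(tnth_mktuple, tnth_reorder) lift_perm_lift.
Qed.

Lemma omit_reorder0 n (t : n.+1.-tuple V) (j : 'I_n.+1) :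
  omit_nth (reorder t (lift_perm j ord0 1)) j = omit_nth t ord0.
Proof.
apply: eq_from_tnth => m.
by rewrite !(tnth_mktuple, tnth_reorder) lift_perm_lift perm1.
Qed.

Lemma perm_lift_permP n (p : 'S_n.+1) j : exists q : 'S_n, p = lift_perm j (p j) q.
Proof.
have pj k : p j != p (lift j k) by rewrite (inj_eq perm_inj) neq_lift.
have qinj : injective (fun k => odflt k (unlift (p j) (p (lift j k)))).
  move=> k l /=; case: (unlift_some (pj k)) => k' hk ->.
  case: (unlift_some (pj l)) => l' hl -> /= e.
  by apply: (@lift_inj _ j); apply: (@perm_inj _ p); rewrite hk hl e.
exists (perm qinj); apply/permP => k; case: (unliftP j k) => [k' ->|->].
  rewrite lift_perm_lift permE; case: (unlift_some (pj k')) => l hl ->.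
  by rewrite hl.
by rewrite lift_perm_id.
Qed.

(** Omitting entry [j] of the reordered tuple amounts to omitting entry [p j] of the original one
    and reordering by the remaining [q]; the sign of [p] is that of [q] times [(-1)^(j + p j)]. *)
Lemma dsum_alternating n (f : n.+1.-tuple V -> R) :
  alternating f -> alternating (dsum f).
Proof.
move=> falt t p; rewrite /dsum mulr_sumr [RHS](reindex_inj (@perm_inj _ p)) /=.
apply: eq_bigr => j _; have [q hq] := perm_lift_permP p j.
rewrite {1}hq reorder_lift_perm falt mulrA [in RHS]mulrA; congr (_ * _).
have -> : odd_perm p = odd j (+) odd (p j) (+) q by rewrite {1}hq odd_lift_perm.
rewrite -[in LHS](signr_odd _ j) -[X in _ = _ * X]signr_odd -!signr_addb.
by congr (_ ^+ _); case: (odd j); case: (odd (p j)); case: (odd_perm q).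
Qed.

Lemma dsum_cons n (f : n.+1.-tuple V -> R) u (s : n.+1.-tuple V) :
  dsum f [tuple of u :: s] =
  f s - \sum_(j < n.+1) (-1) ^+ j * f [tuple of u :: omit_nth s j].
Proof.
rewrite /dsum big_ord_recl omit_cons0 expr0 mul1r; congr (_ + _).
rewrite -sumrN; apply: eq_bigr => j _.
by rewrite omit_cons_lift /= /bump leq0n add1n exprS mulN1r mulNr.
Qed.
End Alternating.

Section Local.
Variables (R : comPzRingType) (Y : finType) (sg : {set Y}).

(** Moving entry [j] of [F] to the front costs the sign [(-1)^j], which cancels the one in [dsum],
    so the [n.+1] terms contribute equally. As the sums run over all tuples, [h] can be
    arbitrary. *)
Lemma dsum_adjoint n (h : n.-tuple Y -> R) (F : n.+1.-tuple Y -> R) :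
  alternating F ->
  \sum_(t : n.+1.-tuple Y | all (mem sg) t) dsum h t * F t =
  n.+1%:R * \sum_(r : n.-tuple Y | all (mem sg) r)
     h r * \sum_(u in sg) F [tuple of u :: r].
Proof.
move=> Falt; under eq_bigr do rewrite mulr_suml.
rewrite exchange_big /=.
set rhs := (X in _ = _ * X).
transitivity (\sum_(j < n.+1) rhs); last by rewrite sumr_const card_ord mulr_natl.
have rhsE : rhs = \sum_(t : n.+1.-tuple Y | all (mem sg) t) h (omit_nth t ord0) * F t.
  transitivity (\sum_(t : n.+1.-tuple Y | (thead t \in sg) && all (mem sg) (omit_nth t ord0))
      h (omit_nth t ord0) * F t).
    rewrite (sum_tuple_cons (mem sg) (fun r => all (mem sg) r)).
    apply: eq_bigr => r _; rewrite mulr_sumr; apply: eq_bigr => u _.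
    by rewrite omit_cons0.
  apply: eq_bigl => t; case/tupleP: t => u r.
  by rewrite omit_cons0 theadE.
apply: eq_bigr => j _; pose p := lift_perm j ord0 (1%g : 'S_n).
rewrite rhsE (reindex_inj (@reorder_inj Y n p)) /=.
under eq_bigl do rewrite all_reorder.
apply: eq_bigr => t _.
rewrite Falt omit_reorder0 /p odd_lift_perm odd_perm1 !addbF signr_odd.
by rewrite mulrACA -exprD addnn -mul2n exprM sqrrN expr1n expr1n mul1r.
Qed.
End Local.

(** * The Laplacian of a finite pure complex *)

Section FiniteComplex.
Variables (R : rcfType) (Y : finType) (Ch : {set {set Y}}) (N : nat).
Hypothesis card_chamber : forall sg, sg \in Ch -> #|sg| = N.
Variable n : nat.
Implicit Types (f g v : n.+1.-tuple Y -> R) (s t : n.+1.-tuple Y) (sg : {set Y}).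

Definition nchambers s : nat := #|[set sg in Ch | all (mem sg) s]|.

Definition contract sg f (r : n.-tuple Y) : R := \sum_(u in sg) f [tuple of u :: r].

(* The vertices [u] of [s] are included in the sums; altogether their terms are
   [n.+1%:R * f s - n.+1%:R * f s = 0]. *)
Definition local_laplace sg f s : R :=
  N%:R * f s - \sum_(j < n.+1) (-1) ^+ j * contract sg f (omit_nth s j).

(** The Laplacian multiplied by the weight of [s]; hence the factor [nchambers s] on the right in
    [eigenfunction]. *)
Definition weighted_laplace f s : R :=
  \sum_(sg in Ch | all (mem sg) s) local_laplace sg f s.

Definition is_cochain f := alternating f /\ forall s, nchambers s = 0%N -> f s = 0.

Definition eigenfunction (a : R) f :=
  [/\ is_cochain f, exists s, f s != 0 &
      forall s, weighted_laplace f s = a * (nchambers s)%:R * f s].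

(* Each simplex is counted with its [n.+1`!] orderings. *)
Definition wdot f g : R := \sum_s (nchambers s)%:R * f s * g s.

Lemma nchambers_sum s : (nchambers s)%:R = \sum_(sg in Ch | all (mem sg) s) 1 :> R.
Proof.
rewrite sumr_const -mulr_natl mulr1; congr _%:R; apply: eq_card => sg.
by rewrite !inE.
Qed.

Lemma nchambers_reorder s p : nchambers (reorder s p) = nchambers s.
Proof. by apply: eq_card => sg; rewrite !inE all_reorder. Qed.

Lemma nchambers_gt0 s sg : sg \in Ch -> all (mem sg) s -> (0 < nchambers s)%N.
Proof. by move=> h h'; apply/card_gt0P; exists sg; rewrite inE h. Qed.

Lemma wdot_local f g :
  wdot f g = \sum_(sg in Ch) \sum_(s : n.+1.-tuple Y | all (mem sg) s) f s * g s.
Proof.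
rewrite (exchange_big_dep predT) //=; apply: eq_bigr => s _.
rewrite nchambers_sum -mulrA mulr_suml; apply: eq_bigr => sg _.
by rewrite mul1r.
Qed.

Lemma weighted_laplace_local f g :
  \sum_s g s * weighted_laplace f s =
  \sum_(sg in Ch) \sum_(s : n.+1.-tuple Y | all (mem sg) s) g s * local_laplace sg f s.
Proof.
rewrite (exchange_big_dep predT) //=; apply: eq_bigr => s _.
by rewrite mulr_sumr.
Qed.

(** The subtracted part of [local_laplace] is [dsum] of the contraction, and [dsum_adjoint] moves it
    onto [g]. The outcome is symmetric in [f] and [g], which gives self-adjointness, and for [f = g]
    it subtracts squares, which gives the upper bound. *)
Lemma local_laplace_form sg f g : alternating g ->
  \sum_(s : n.+1.-tuple Y | all (mem sg) s) g s * local_laplace sg f s =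
  N%:R * (\sum_(s : n.+1.-tuple Y | all (mem sg) s) f s * g s) -
  n.+1%:R * \sum_(r : n.-tuple Y | all (mem sg) r) contract sg f r * contract sg g r.
Proof.
move=> galt; rewrite -(dsum_adjoint sg (contract sg f) galt) mulr_sumr -sumrB.
by apply: eq_bigr => s _; rewrite /local_laplace /dsum; ring.
Qed.

Lemma weighted_laplace_form f g : alternating g ->
  \sum_s g s * weighted_laplace f s = N%:R * wdot f g -
  n.+1%:R * \sum_(sg in Ch) \sum_(r : n.-tuple Y | all (mem sg) r)
    contract sg f r * contract sg g r.
Proof.
move=> galt; rewrite weighted_laplace_local wdot_local !mulr_sumr -sumrB.
by apply: eq_bigr => sg _; rewrite local_laplace_form.
Qed.

Lemma wdotC f g : wdot f g = wdot g f.
Proof. by apply: eq_bigr => s _; ring. Qed.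

Lemma weighted_laplace_sym f g : alternating f -> alternating g ->
  \sum_s g s * weighted_laplace f s = \sum_s f s * weighted_laplace g s.
Proof.
move=> falt galt; rewrite !weighted_laplace_form // wdotC; congr (_ - _ * _).
by apply: eq_bigr => sg _; apply: eq_bigr => r _; rewrite mulrC.
Qed.

Lemma wdot_gt0 f : is_cochain f -> (exists s, f s != 0) -> 0 < wdot f f.
Proof.
move=> [_ f0] [s fs]; rewrite /wdot (bigD1 s) //=; apply: ltr_wpDr.
  by apply: sumr_ge0 => t _; rewrite -mulrA mulr_ge0 // -expr2 sqr_ge0.
rewrite -mulrA -expr2; apply: mulr_gt0; last by rewrite exprn_even_gt0.
by rewrite ltr0n lt0n; apply/negP => /eqP/f0/eqP; apply/negP.
Qed.

Lemma eigenfunction_le a f : eigenfunction a f -> a <= N%:R.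
Proof.
move=> [fc f0 hf]; have [falt _] := fc.
have := weighted_laplace_form f falt.
under eq_bigr do rewrite hf.
have -> : \sum_s f s * (a * (nchambers s)%:R * f s) = a * wdot f f.
  by rewrite mulr_sumr; apply: eq_bigr => s _; ring.
move=> e; rewrite -(ler_pM2r (wdot_gt0 fc f0)) e gerBl mulr_ge0 //.
by apply: sumr_ge0 => sg _; apply: sumr_ge0 => r _; rewrite -expr2 sqr_ge0.
Qed.

Lemma local_laplace_dsum sg f s : sg \in Ch ->
  local_laplace sg f s = \sum_(u in sg) dsum f [tuple of u :: s].
Proof.
move=> sgC; under [RHS]eq_bigr do rewrite dsum_cons.
rewrite /local_laplace.
rewrite sumrB sumr_const card_chamber // mulr_natl; congr (_ - _).
by rewrite exchange_big; apply: eq_bigr => j _; rewrite mulr_sumr.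
Qed.

Lemma reorder_cons m (u : Y) (s : m.+1.-tuple Y) (p : 'S_m.+1) :
  reorder [tuple of u :: s] (lift_perm ord0 ord0 p) = [tuple of u :: reorder s p].
Proof.
apply: eq_from_tnth => k; rewrite tnth_reorder.
case: (unliftP ord0 k) => [k' ->|->].
  by rewrite lift_perm_lift !tnthS tnth_reorder.
by rewrite lift_perm_id !tnth0.
Qed.

Lemma weighted_laplace_cochain f : alternating f -> is_cochain (weighted_laplace f).
Proof.
move=> falt; split; last first.
  move=> s s0; rewrite /weighted_laplace big1 // => sg /andP[sgC hs].
  by have := nchambers_gt0 sgC hs; rewrite s0.
move=> s p; rewrite /weighted_laplace mulr_sumr.
under eq_bigl do rewrite all_reorder.
apply: eq_bigr => sg /andP[sgC _]; rewrite !local_laplace_dsum // mulr_sumr.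
apply: eq_bigr => u _.
by rewrite -reorder_cons (dsum_alternating falt) odd_lift_perm.
Qed.

(** Pairing the weighted Laplacian of [f] with [f] gives, up to the factor [n.+2], the sum of the
    squares of [dsum f] over all tuples of all chambers; so the kernel consists of cocycles. *)
Lemma weighted_laplace_eq0 f sg (t : n.+2.-tuple Y) :
  is_cochain f -> (forall s, weighted_laplace f s = 0) ->
  sg \in Ch -> all (mem sg) t -> dsum f t = 0.
Proof.
move=> [falt _] hf sgC ht.
have e : \sum_(sg in Ch) \sum_(t : n.+2.-tuple Y | all (mem sg) t) dsum f t ^+ 2 = 0.
  transitivity (\sum_(sg in Ch) n.+2%:R *
      \sum_(s : n.+1.-tuple Y | all (mem sg) s) f s * local_laplace sg f s).
    apply: eq_bigr => sg' sgC'; under eq_bigr do rewrite expr2.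
    rewrite (dsum_adjoint _ _ (dsum_alternating falt)).
    congr (_ * _); apply: eq_bigr => s _.
    by rewrite local_laplace_dsum.
  rewrite -mulr_sumr -weighted_laplace_local big1 ?mulr0 // => s _.
  by rewrite hf mulr0.
move: e => /eqP; rewrite psumr_eq0; last first.
  by move=> sg' _; apply: sumr_ge0 => t' _; rewrite sqr_ge0.
move=> /allP/(_ sg (mem_index_enum _)); rewrite sgC /= psumr_eq0; last first.
  by move=> t' _; rewrite sqr_ge0.
by move=> /allP/(_ t (mem_index_enum _)); rewrite ht /= sqrf_eq0 => /eqP.
Qed.

(** The projection of all functions onto the cochains. It is self-adjoint against cochains, and it
    lets the spectral argument use the delta functions of tuples as a basis. *)
Definition alternation f s : R :=
  if nchambers s == 0%N then 0 else
  (n.+1`!%:R)^-1 * \sum_(p : 'S_n.+1) (-1) ^+ p * f (reorder s p).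

Lemma alternation_cochain f : is_cochain (alternation f).
Proof.
split; last by move=> s s0; rewrite /alternation s0 eqxx.
move=> s p; rewrite /alternation nchambers_reorder.
case: ifP => _; first by rewrite mulr0.
rewrite mulrCA; congr (_ * _); rewrite mulr_sumr.
rewrite (reindex_inj (mulIg p^-1%g)) /=; apply: eq_bigr => q _.
rewrite reorderM mulgKV mulrA -signr_addb odd_permM odd_permV.
by rewrite addbC.
Qed.

Lemma alternation_id f : is_cochain f -> alternation f =1 f.
Proof.
move=> [falt f0] s; rewrite /alternation; case: ifPn => [/eqP/f0 -> //|_].
under eq_bigr do rewrite falt mulrA -expr2 sqrr_sign mul1r.
have fne0 : (n.+1`!%:R : R) != 0 by rewrite pnatr_eq0 -lt0n fact_gt0.
by rewrite sumr_const card_Sn -(mulr_natl (f s)) mulrA mulVf ?mul1r.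
Qed.

Lemma alternation_adjoint f g : is_cochain g ->
  \sum_s alternation f s * g s = \sum_s f s * g s.
Proof.
move=> [galt g0].
have fne0 : (n.+1`!%:R : R) != 0 by rewrite pnatr_eq0 -lt0n fact_gt0.
transitivity ((n.+1`!%:R)^-1 * \sum_(p : 'S_n.+1) \sum_s f s * g s); last first.
  by rewrite sumr_const card_Sn -(mulr_natl (\sum_s f s * g s)) mulrA mulVf ?mul1r.
transitivity ((n.+1`!%:R)^-1 *
    \sum_s \sum_(p : 'S_n.+1) (-1) ^+ p * f (reorder s p) * g s).
  rewrite mulr_sumr; apply: eq_bigr => s _; rewrite /alternation.
  case: ifPn => [/eqP/g0 -> |_]; last by rewrite -mulrA mulr_suml.
  by rewrite mulr0 big1 ?mulr0 // => p _; rewrite mulr0.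
congr (_ * _); rewrite exchange_big; apply: eq_bigr => p _.
rewrite [RHS](reindex_inj (@reorder_inj Y n p)); apply: eq_bigr => s _.
by rewrite galt mulrCA mulrA.
Qed.

End FiniteComplex.

(** * The least non-zero eigenvalue *)

Section MinEigenvalue.
Variables (R : rcfType) (Y : finType) (Ch : {set {set Y}}) (N : nat).
Hypothesis card_chamber : forall sg, sg \in Ch -> #|sg| = N.
Variable n : nat.
Implicit Types (f g v : n.+1.-tuple Y -> R) (s t : n.+1.-tuple Y) (sg : {set Y}).

Local Notation nchambers := (nchambers Ch).
Local Notation weighted_laplace := (weighted_laplace Ch N).
Local Notation is_cochain := (is_cochain Ch).
Local Notation wdot := (wdot Ch).
Local Notation eigenfunction := (eigenfunction Ch N).

Lemma weighted_laplace_sum (I : finType) (c : I -> R) (F : I -> n.+1.-tuple Y -> R) t :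
  weighted_laplace (fun s => \sum_k c k * F k s) t =
  \sum_k c k * weighted_laplace (F k) t.
Proof.
under [RHS]eq_bigr do rewrite mulr_sumr.
rewrite exchange_big; apply: eq_bigr => sg _.
rewrite /local_laplace mulr_sumr.
under [RHS]eq_bigr do rewrite mulrBr.
rewrite sumrB; congr (_ - _); first by apply: eq_bigr => k _; rewrite mulrCA.
under [RHS]eq_bigr do rewrite mulr_sumr.
rewrite exchange_big; apply: eq_bigr => j _.
under [RHS]eq_bigr do rewrite mulrCA.
rewrite -mulr_sumr; congr (_ * _).
rewrite /contract exchange_big; apply: eq_bigr => k _.
by rewrite mulr_sumr.
Qed.

Lemma alternation_sum (I : finType) (c : I -> R) (F : I -> n.+1.-tuple Y -> R) t :
  alternation Ch (fun s => \sum_k c k * F k s) t =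
  \sum_k c k * alternation Ch (F k) t.
Proof.
rewrite /alternation; case: ifP => _; first by rewrite big1 // => k _; rewrite mulr0.
under [RHS]eq_bigr do rewrite mulrCA.
rewrite -mulr_sumr; congr (_ * _).
under [RHS]eq_bigr do rewrite mulr_sumr.
rewrite exchange_big; apply: eq_bigr => p _.
by rewrite mulr_sumr; apply: eq_bigr => k _; rewrite mulrCA.
Qed.

Definition delta s t : R := (t == s)%:R.

Lemma delta_sum f t : \sum_s delta t s * f s = f t.
Proof.
rewrite (bigD1 t) //= /delta eqxx mul1r big1 ?addr0 // => s /negPf st.
by rewrite st mul0r.
Qed.

Lemma sum_delta f t : \sum_s f s * delta s t = f t.
Proof.
rewrite (bigD1 t) //= /delta eqxx mulr1 big1 ?addr0 // => s /negPf st.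
by rewrite eq_sym st mulr0.
Qed.

Lemma eq_weighted_laplace f g : f =1 g -> weighted_laplace f =1 weighted_laplace g.
Proof.
move=> fg s; apply: eq_bigr => sg _; rewrite /local_laplace fg; congr (_ - _).
apply: eq_bigr => j _; congr (_ * _); apply: eq_bigr => u _; exact: fg.
Qed.

(** The matrix [S] represents the weighted Laplacian precomposed with [alternation], on all
    functions of tuples. The functions killed by the projection only contribute to the eigenvalue 0,
    which is excluded. *)
Lemma min_eigenfunction (c : R) v :
  is_cochain v -> (exists s, v s != 0) ->
  (forall f, is_cochain f -> (forall s, weighted_laplace f s = 0) -> wdot f v = 0) ->
  \sum_s v s * weighted_laplace v s <= c * wdot v v ->
  exists m, [/\ exists f, eigenfunction m f, m != 0, m <= c &
    forall a f, eigenfunction a f -> a != 0 -> m <= a].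
Proof.
move=> vc v0 vker hv.
pose S s t := weighted_laplace (alternation Ch (delta s)) t.
(* Zero weights are replaced by 1 to keep the product definite; cochains vanish at these tuples. *)
pose d s : R := if nchambers s == 0%N then 1 else (nchambers s)%:R.
have d_gt0 s : 0 < d s.
  by rewrite /d; case: ifPn => //; rewrite -lt0n ltr0n.
have altc f : is_cochain (alternation Ch f) by exact: alternation_cochain.
have wlc f : is_cochain (weighted_laplace (alternation Ch f)).
  by apply: weighted_laplace_cochain => //; case: (altc f).
have SE u t : \sum_s u s * S s t = weighted_laplace (alternation Ch u) t.
  rewrite /S -weighted_laplace_sum; apply: eq_weighted_laplace => s.
  rewrite -alternation_sum /alternation; case: ifP => // _; congr (_ * _).
  by apply: eq_bigr => p _; rewrite sum_delta.
have S_sym s t : S s t = S t s.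
  rewrite /S -[LHS]delta_sum -[RHS]delta_sum.
  rewrite -(alternation_adjoint _ (wlc _)) -[RHS](alternation_adjoint _ (wlc _)).
  by apply: weighted_laplace_sym => //; case: (altc (delta s)); case: (altc (delta t)).
have dE f s : is_cochain f -> d s * f s = (nchambers s)%:R * f s.
  by rewrite /d => -[_ f0]; case: eqP => [/f0 ->|//]; rewrite !mulr0.
have dot_d u f : is_cochain f -> \sum_s d s * u s * f s = wdot (alternation Ch u) f.
  move=> fc; pose g s := d s * f s.
  have gc : is_cochain g.
    case: (fc) => falt f0; split=> [s p|s /f0 fs]; last by rewrite /g fs mulr0.
    by rewrite /g /d nchambers_reorder falt mulrCA.
  transitivity (\sum_s u s * g s).
    by apply: eq_bigr => s _; rewrite /g mulrAC mulrC.
  rewrite -(alternation_adjoint u gc); apply: eq_bigr => s _.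
  by rewrite /g dE // mulrCA mulrA.
have eigP a : a != 0 -> weighted_eigenvalue d S a <-> exists f, eigenfunction a f.
  move=> a0; split=> [[u u0 hu]|[f [fc f0 hf]]]; last first.
    exists f => // t; rewrite SE (eq_weighted_laplace (alternation_id fc)) hf.
    by rewrite -!mulrA dE.
  (* Since [a] is non-zero, [u] is a value of the weighted Laplacian divided by [a * d], and [d] is
     positive and invariant under reordering. *)
  have uc : is_cochain u.
    have [walt w0] := wlc u.
    split=> [s p|s s0].
      have := hu (reorder s p); rewrite SE walt -SE hu /d nchambers_reorder -/(d s).
      rewrite mulrCA => /mulfI -> //.
      by rewrite mulf_neq0 // gt_eqF.
    have := hu s; rewrite SE w0 // => /esym/eqP; rewrite !mulf_eq0 (negPf a0) /=.
    by rewrite gt_eqF //= => /eqP.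
  exists u; split => // s.
  by rewrite -(eq_weighted_laplace (alternation_id uc)) -SE hu -!mulrA dE.
have [] := @weighted_min_eigenvalue R _ d S d_gt0 S_sym c v v0.
- move=> u hu; rewrite dot_d //; apply: vker => // s; by rewrite -SE.
- have -> : \sum_s d s * v s ^+ 2 = wdot v v.
    by apply: eq_bigr => s _; rewrite expr2 mulrA dE.
  apply: le_trans hv; rewrite le_eqVlt; apply/orP; left; apply/eqP.
  apply: eq_bigr => s _; rewrite SE mulrC; congr (_ * _).
  exact/eq_weighted_laplace/alternation_id.
- move=> m [hm m0 mc mmin]; exists m; split => //; first exact/eigP.
  by move=> a f haf a0; apply: mmin => //; apply/eigP => //; exists f.
Qed.

End MinEigenvalue.

(** * Chambers with exactly one vertex of each type *)

Section Typed.
Variables (R : rcfType) (Y : finType) (Ch : {set {set Y}}) (N : nat).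
Hypothesis card_chamber : forall sg, sg \in Ch -> #|sg| = N.
Variable tau : Y -> 'I_N.
Hypothesis tau_inj : forall sg, sg \in Ch -> {in sg &, injective tau}.
Variable n : nat.
Implicit Types (f g v : n.+1.-tuple Y -> R) (s t : n.+1.-tuple Y) (sg : {set Y}).

Lemma tau_image sg : sg \in Ch -> tau @: sg = [set: 'I_N].
Proof.
move=> sgC; apply/eqP; rewrite eqEcard finset.subsetT cardsT card_ord /=.
by rewrite card_in_imset ?card_chamber // => x y; exact: tau_inj.
Qed.

Lemma sum_types sg (F : 'I_N -> R) : sg \in Ch ->
  \sum_(u in sg) F (tau u) = \sum_k F k.
Proof.
move=> sgC; rewrite -(big_imset F (tau_inj sgC)) tau_image //.
by apply: eq_bigl => k; rewrite inE.
Qed.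

Lemma omit_all sg m (s : m.+1.-tuple Y) j : all (mem sg) s -> all (mem sg) (omit_nth s j).
Proof.
by move=> /all_tnthP h; apply/all_tnthP => k; rewrite tnth_mktuple.
Qed.

(* Summed over the vertices of a chamber, the row of a vertex becomes a second row
   of ones. *)
Definition type_matrix s : 'M[R]_n.+2 := \matrix_(a, b)
  oapp (fun a' : 'I_n.+1 => ((tau (tnth s a') : nat) == b)%:R) 1 (unlift ord0 a).

Definition type_cochain s : R :=
  if nchambers Ch s == 0%N then 0 else \det (type_matrix s).

Lemma det_type_matrix_reorder s p :
  \det (type_matrix (reorder s p)) = (-1) ^+ p * \det (type_matrix s).
Proof.
have -> : type_matrix (reorder s p) = row_perm (lift_perm ord0 ord0 p) (type_matrix s).
  apply/matrixP => a b; rewrite !mxE.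
  case: (unliftP ord0 a) => [a' ->|->].
    by rewrite lift_perm_lift !liftK /= tnth_reorder.
  by rewrite lift_perm_id unlift_none.
by rewrite row_permE det_mulmx det_perm odd_lift_perm.
Qed.

(** By the bound on [n], each of the [n.+2] column indices is the type of exactly one vertex of
    [sg], so every entry of the summed row is 1. The determinant then has two equal rows. *)
Lemma contract_type_cochain sg (r : n.-tuple Y) : (n < N.-1)%N ->
  sg \in Ch -> all (mem sg) r -> contract sg type_cochain r = 0.
Proof.
move=> nN sgC hr; pose a1 : 'I_n.+2 := lift ord0 ord0.
have u0 : exists u, u \in sg.
  apply/card_gt0P; rewrite card_chamber //; by case: N nN.
case: u0 => u0 u0sg.
pose t0 := [tuple of u0 :: r].
(* Row [a1] is the only one that depends on [u], and the cofactors along it omit it. *)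
have cof u b : cofactor (type_matrix [tuple of u :: r]) a1 b = cofactor (type_matrix t0) a1 b.
  rewrite /cofactor; congr (_ * \det _); apply/matrixP => a c; rewrite !mxE.
  case: (unliftP ord0 (lift a1 a)) => [a' ha|_] //=.
  case: (unliftP ord0 a') ha => [a'' ->|->]; first by rewrite !tnthS.
  by move=> /eqP; rewrite eq_sym (negPf (neq_lift _ _)).
transitivity (\sum_b cofactor (type_matrix t0) a1 b).
  rewrite /contract.
  transitivity (\sum_(u in sg) \sum_(b < n.+2)
      ((tau u : nat) == b)%:R * cofactor (type_matrix t0) a1 b).
    apply: eq_bigr => u usg; rewrite /type_cochain ifN; last first.
      by rewrite -lt0n; apply: (nchambers_gt0 sgC) => /=; rewrite usg.
    rewrite (expand_det_row _ a1); apply: eq_bigr => b _.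
    by rewrite cof mxE liftK /=.
  rewrite exchange_big; apply: eq_bigr => b _; rewrite -mulr_suml.
  have bN : (b < N)%N by apply: (leq_trans (ltn_ord b)); case: N nN.
  rewrite (sum_types (fun k : 'I_N => ((k : nat) == b)%:R) sgC).
  rewrite (bigD1 (Ordinal bN)) //= eqxx big1 ?addr0 ?mul1r // => k.
  by rewrite -val_eqE /= => /negPf ->.
pose M : 'M[R]_n.+2 := \matrix_(a, b) if a == a1 then 1 else type_matrix t0 a b.
transitivity (\det M).
  rewrite (expand_det_row _ a1); apply: eq_bigr => b _.
  rewrite mxE eqxx mul1r /cofactor; congr (_ * \det _); apply/matrixP => a c.
  have hl : (lift a1 a == a1) = false by rewrite eq_sym (negPf (neq_lift _ _)).
  by rewrite !mxE hl.
apply: (@determinant_alternate _ _ _ ord0 a1) => // b.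
by rewrite !mxE eqxx unlift_none.
Qed.

Lemma type_cochain_eigenfunction : (n < N.-1)%N -> Ch != finset.set0 ->
  eigenfunction Ch N N%:R type_cochain.
Proof.
move=> nN /set0Pn[sg sgC]; split.
- split=> [s p|s s0]; last by rewrite /type_cochain s0 eqxx.
  rewrite /type_cochain nchambers_reorder; case: ifP => _; rewrite ?mulr0 //.
  exact: det_type_matrix_reorder.
(* On vertices of types [1, ..., n.+1] the type matrix is triangular with unit diagonal; type 0 is
   left to the row of ones. *)
- have vert (a : 'I_n.+1) : exists u, (u \in sg) && ((tau u : nat) == a.+1).
    have aN : (a.+1 < N)%N.
      by rewrite -ltn_predRL (leq_ltn_trans _ nN) // -ltnS.
    have : Ordinal aN \in tau @: sg by rewrite tau_image // inE.
    by case/imsetP => u usg hu; exists u; rewrite usg -hu /=.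
  pose s := [tuple xchoose (vert a) | a < n.+1].
  have hs a : (tnth s a \in sg) /\ (tau (tnth s a) : nat) = a.+1.
    by rewrite tnth_mktuple; have /andP[? /eqP] := xchooseP (vert a).
  exists s; rewrite /type_cochain ifN; last first.
    rewrite -lt0n; apply: (nchambers_gt0 sgC); apply/all_tnthP => a.
    by case: (hs a).
  rewrite -det_tr det_trig; last first.
    apply/is_trig_mxP => b a ab; rewrite !mxE.
    case: (unliftP ord0 a) ab => [a' ->|->]; last by rewrite ltn0.
    rewrite /= /bump leq0n add1n; case: (hs a') => _ -> h.
    by rewrite gtn_eqF.
  rewrite big1 ?oner_eq0 // => a _; rewrite !mxE.
  case: (unliftP ord0 a) => [a' ->|->] //.
  by rewrite /= /bump leq0n add1n; case: (hs a') => _ ->; rewrite eqxx.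
- move=> s; rewrite nchambers_sum mulr_sumr mulr_suml.
  apply: eq_bigr => sg' /andP[sg'C hs].
  rewrite mulr1 /local_laplace big1 ?subr0 // => j _.
  by rewrite contract_type_cochain ?mulr0 // omit_all.
Qed.

(** * The cochain dual to a cycle [Z] with coefficients [eps], where [phi j] is a reflection moving
    only entry [j] *)

Section Cycle.
Variables (J : 'I_n.+1 -> 'I_N) (Z : {set n.+1.-tuple Y}) (eps : n.+1.-tuple Y -> R).
Variables (phi : 'I_n.+1 -> n.+1.-tuple Y -> n.+1.-tuple Y) (y0 : Y).
Hypothesis J_inj : injective J.
Hypothesis Z_type : forall s, s \in Z -> forall k, tau (tnth s k) = J k.
Hypothesis Z_cone : forall s, s \in Z ->
  exists2 sg, sg \in Ch & all (mem sg) [tuple of y0 :: s].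
Hypothesis phiZ : forall j s, s \in Z -> phi j s \in Z.
Hypothesis phiK : forall j s, s \in Z -> phi j (phi j s) = s.
Hypothesis phi_omit : forall j s, s \in Z -> omit_nth (phi j s) j = omit_nth s j.
Hypothesis phi_eps : forall j s, s \in Z -> eps (phi j s) = - eps s.
Variable s0 : n.+1.-tuple Y.
Hypotheses (s0Z : s0 \in Z) (s0eps : eps s0 != 0).

(** Dividing by [nchambers Ch t] compensates the weight in [wdot], so that the product with a
    cochain [f] is the sum of the [eps t * f t]. *)
Let cycle_dual s : R := \sum_(t in Z)
  eps t / (nchambers Ch t)%:R * alternation Ch (delta R t) s.

Lemma cycle_dual_cochain : is_cochain Ch cycle_dual.
Proof.
split=> [s p|s s0']; rewrite /cycle_dual.
  rewrite mulr_sumr; apply: eq_bigr => t _.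
  by have [alt _] := @alternation_cochain R Y Ch n (delta R t); rewrite alt mulrCA.
by rewrite big1 // => t _; rewrite /alternation s0' eqxx mulr0.
Qed.

Lemma Z_nchambers t : t \in Z -> (0 < nchambers Ch t)%N.
Proof.
by move=> /Z_cone[sg sgC /= /andP[_ h]]; apply: nchambers_gt0 sgC h.
Qed.

Lemma wdot_cycle_dual f : is_cochain Ch f ->
  wdot Ch f cycle_dual = \sum_(t in Z) eps t * f t.
Proof.
move=> [falt f0]; pose g s := (nchambers Ch s)%:R * f s.
have gc : is_cochain Ch g.
  split=> [s p|s s0']; first by rewrite /g nchambers_reorder falt mulrCA.
  by rewrite /g f0 // mulr0.
transitivity (\sum_s \sum_(t in Z) eps t / (nchambers Ch t)%:R *
    (alternation Ch (delta R t) s * g s)).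
  apply: eq_bigr => s _; rewrite /cycle_dual mulr_sumr; apply: eq_bigr => t _.
  by rewrite /g [LHS]mulrC mulrA.
rewrite exchange_big; apply: eq_bigr => t tZ; rewrite -mulr_sumr.
rewrite alternation_adjoint // delta_sum /g mulrA divfK //.
by rewrite pnatr_eq0 -lt0n Z_nchambers.
Qed.

Lemma cycle_dual_ker f : is_cochain Ch f -> (forall s, weighted_laplace Ch N f s = 0) ->
  wdot Ch f cycle_dual = 0.
Proof.
move=> fc hf; rewrite wdot_cycle_dual //; pose h (r : n.-tuple Y) := f [tuple of y0 :: r].
(* The cocycle condition on the cone over [t] with apex [y0] exhibits [f t] as the coboundary of
   [h]. *)
have fE t : t \in Z -> f t = \sum_(j < n.+1) (-1) ^+ j * h (omit_nth t j).
  move=> /Z_cone[sg sgC ht]; have := weighted_laplace_eq0 card_chamber fc hf sgC ht.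
  by rewrite dsum_cons => /eqP; rewrite subr_eq0 => /eqP.
transitivity (\sum_(j < n.+1) (-1) ^+ j * \sum_(t in Z) eps t * h (omit_nth t j)).
  under [RHS]eq_bigr do rewrite mulr_sumr.
  rewrite exchange_big; apply: eq_bigr => t tZ; rewrite fE // mulr_sumr.
  by apply: eq_bigr => j _; rewrite mulrCA.
rewrite big1 // => j _.
set S := \sum_(t in Z) _; suff -> : S = 0 by rewrite mulr0.
(* The involution [phi j] of [Z] keeps the face that omits entry [j] and reverses [eps]. *)
have : S = - S.
  rewrite {1}/S (reindex_onto (phi j) (phi j)) /=; last by move=> t tZ; exact: phiK.
  rewrite (eq_bigl (mem Z)) => [|t]; last first.
    apply/andP/idP => [[tZ /eqP <-]|tZ]; first exact: phiZ.
    by rewrite phiK // phiZ.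
  by rewrite -sumrN; apply: eq_bigr => t tZ; rewrite phi_eps // phi_omit // mulNr.
by move/eqP; rewrite -addr_eq0 -mulr2n mulrn_eq0 /= => /eqP.
Qed.

Lemma cycle_dual_support s : cycle_dual s != 0 -> exists p, reorder s p \in Z.
Proof.
move=> hs; have [/existsP//|] := boolP [exists p, reorder s p \in Z].
rewrite negb_exists => /forallP nZ; move: hs; rewrite /cycle_dual big1 ?eqxx // => t tZ.
rewrite /alternation; case: ifP => _; first by rewrite mulr0.
rewrite big1 ?mulr0 // => p _; rewrite /delta (_ : _ == _ = false) ?mulr0 //.
by apply: contraNF (nZ p) => /eqP ->.
Qed.

Lemma cycle_dual_types s : cycle_dual s != 0 ->
  exists p : 'S_n.+1, forall k, tau (tnth s (p k)) = J k.
Proof.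
move=> /cycle_dual_support[p hp]; exists p => k.
by rewrite -tnth_reorder Z_type.
Qed.

(** No cancellation occurs at [s0]: all members of [Z] list the distinct types [J] in the same
    order, so no non-trivial reordering of [s0] lies in [Z]. *)
Lemma cycle_dual_neq0 : cycle_dual s0 != 0.
Proof.
have m0 : n.+1`!%:R != 0 :> R by rewrite pnatr_eq0 -lt0n fact_gt0.
have ch0 := Z_nchambers s0Z.
have altE t : t \in Z -> alternation Ch (delta R t) s0 = (n.+1`!%:R)^-1 * (s0 == t)%:R.
  move=> tZ; rewrite /alternation gtn_eqF //; congr (_ * _).
  rewrite (bigD1 1%g) //= odd_perm1 expr0 mul1r reorder1 big1 ?addr0 // => p p1.
  rewrite /delta (_ : _ == _ = false) ?mulr0 //; apply: contraNF p1 => /eqP hp.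
  apply/eqP/permP => k; rewrite perm1; apply: J_inj.
  by rewrite -(Z_type s0Z) -tnth_reorder hp (Z_type tZ).
rewrite /cycle_dual (bigD1 s0) //= altE // eqxx mulr1 big1 ?addr0; last first.
  by move=> t /andP[tZ /negPf ts]; rewrite altE // eq_sym ts !mulr0.
by rewrite !mulf_neq0 ?invr_neq0 // pnatr_eq0 -lt0n.
Qed.

(** The types of a tuple in the support are those of [J]. The omitted entry is thus the only vertex
    of [sg] whose type completes the remaining ones, and moving it back to its place gives the
    sign. *)
Lemma contract_cycle_dual sg s j : sg \in Ch -> all (mem sg) s -> cycle_dual s != 0 ->
  contract sg cycle_dual (omit_nth s j) = (-1) ^+ j * cycle_dual s.
Proof.
move=> sgC hs ts; have [q hq] := cycle_dual_types ts.
rewrite /contract (bigD1 (tnth s j)) /=; last by move/all_tnthP: hs; apply.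
rewrite big1 ?addr0 => [|u /andP[usg usj]].
  have -> : [tuple of tnth s j :: omit_nth s j] = reorder s (lift_perm ord0 j 1).
    apply: eq_from_tnth => k; rewrite tnth_reorder.
    case: (unliftP ord0 k) => [k' ->|->].
      by rewrite lift_perm_lift perm1 tnthS tnth_mktuple.
    by rewrite lift_perm_id tnth0.
  have [talt _] := cycle_dual_cochain.
  by rewrite talt odd_lift_perm odd_perm1 addbF addFb signr_odd.
apply/eqP; apply: contraNT usj => tu; have [p hp] := cycle_dual_types tu.
set t := [tuple of u :: omit_nth s j] in hp.
have tinj : injective (fun a => tau (tnth t a)).
  move=> a b; rewrite -[a](permKV p) -[b](permKV p) !hp => /J_inj.
  by move/perm_inj => ->.
have hu : tau u = tau (tnth s (q (p^-1%g ord0))).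
  by rewrite hq -hp permKV tnth0.
case: (unliftP j (q (p^-1%g ord0))) hu => [k ->|->] hu.
  have /tinj // : tau (tnth t ord0) = tau (tnth t (lift ord0 k)).
  by rewrite tnth0 tnthS tnth_mktuple.
by apply/eqP/(tau_inj sgC) => //; move/all_tnthP: hs; apply.
Qed.

Lemma cycle_dual_energy :
  \sum_s cycle_dual s * weighted_laplace Ch N cycle_dual s =
  (N%:R - n.+1%:R) * wdot Ch cycle_dual cycle_dual.
Proof.
rewrite mulr_sumr; apply: eq_bigr => s _.
have [->|ts] := eqVneq (cycle_dual s) 0; first by rewrite !(mulr0, mul0r).
have -> : weighted_laplace Ch N cycle_dual s =
    (nchambers Ch s)%:R * ((N%:R - n.+1%:R) * cycle_dual s).
  rewrite nchambers_sum mulr_suml; apply: eq_bigr => sg /andP[sgC hs].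
  rewrite mul1r mulrBl /local_laplace; congr (_ - _).
  transitivity (\sum_(j < n.+1) cycle_dual s); last by rewrite sumr_const card_ord mulr_natl.
  apply: eq_bigr => j _.
  by rewrite contract_cycle_dual // mulrA -expr2 sqrr_sign mul1r.
by rewrite mulrC; ring.
Qed.

Lemma min_eigenvalue_of_cycle :
  exists m, [/\ exists f, eigenfunction Ch N m f, m != 0, m <= N%:R - n.+1%:R &
    forall a f, eigenfunction Ch N a f -> a != 0 -> m <= a].
Proof.
apply: (min_eigenfunction card_chamber (v := cycle_dual)) => //.
- exact: cycle_dual_cochain.
- by exists s0; exact: cycle_dual_neq0.
- exact: cycle_dual_ker.
- by rewrite cycle_dual_energy.
Qed.

End Cycle.
End Typed.

(** * Complexes with types *)

Local Open Scope classical_set_scope.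
Local Open Scope ring_scope.

Lemma alternating_repeated (R : numDomainType) (V : choiceType) i
    (f : i.+1.-tuple V -> R) (s : i.+1.-tuple V) :
  alternating f -> ~~ uniq s -> f s = 0.
Proof.
move=> falt; pose x0 := thead s; move=> /(uniqPn x0)[a [b [ab bs sab]]].
rewrite size_tuple in bs; have as' := ltn_trans ab bs.
pose p := tperm (Ordinal as') (Ordinal bs).
have sE : reorder s p = s.
  apply: eq_from_tnth => k; rewrite tnth_reorder /p.
  by case: tpermP => [->|->|//]; rewrite !(tnth_nth x0) /= sab.
have := falt s p; rewrite sE odd_tperm /=.
have -> : (Ordinal as' != Ordinal bs) = true by rewrite -val_eqE /= neq_ltn ab.
rewrite expr1 mulN1r => /eqP; rewrite -addr_eq0 -mulr2n mulrn_eq0 /=.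
by move/eqP.
Qed.

(** * Transfer from cochains of the complex to functions of tuples over its finite vertex set *)

Section Transfer.
Variables (R : realType) (V : choiceType) (X : set {fset V}) (l : nat).
Variable tau : V -> 'I_l.+1.
Hypothesis X_fin : finite_set X.
Hypothesis X_sub : forall s t : {fset V}, X t -> (s `<=` t)%fset -> s != fset0 -> X s.
Hypothesis X_pure : forall s, X s ->
  exists sg, [/\ X sg, (s `<=` sg)%fset & #|` sg| = l.+1].
Hypothesis X_tau : forall s, X s -> {in s &, injective tau}.
Hypothesis X_ne : X !=set0.

Lemma dimension_eq : dimension X = l.
Proof.
apply/eqP; rewrite /dimension eqn_leq; apply/andP; split.
  apply/bigmax_leqP_seq => s; rewrite in_fset_set // inE => Xs _.
  rewrite -ltnS; apply: (@leq_ltn_trans #|` s|.-1) => //.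
  have : (#|` s| <= l.+1)%N.
    rewrite -[X in (_ <= X)%N]card_ord cardfE.
    apply: (@leq_card _ _ (fun x : s => tau (val x))) => x y h.
    by apply: val_inj; apply: (X_tau Xs) h; exact: valP.
  by case: #|` s|.
case: X_ne => s /X_pure[sg [Xsg _ sgl]].
have -> : l = (#|` sg|).-1 by rewrite sgl.
by apply: (@leq_bigmax_seq _ _ xpredT (fun s : {fset V} => (#|` s|).-1));
  rewrite ?in_fset_set ?inE.
Qed.

Let Vt : {fset V} := (\bigcup_(s <- fset_set X) s)%fset.
Let Y : finType := Vt.

Lemma Vt_simplex s x : X s -> x \in s -> x \in Vt.
Proof.
move=> Xs xs; apply/bigfcupP; exists s => //; rewrite in_fset_set // andbT.
by rewrite inE.
Qed.

Definition vset (sg : {set Y}) : {fset V} := [fset val y | y in sg]%fset.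

Lemma in_vset sg (y : Y) : (val y \in vset sg) = (y \in sg).
Proof.
apply/imfsetP/idP => [[y' /= y'sg /val_inj ->//]|ysg].
by exists y.
Qed.

Lemma vset_inj : injective vset.
Proof. by move=> s t e; apply/setP => y; rewrite -!in_vset e. Qed.

Lemma card_vset sg : #|` vset sg| = #|sg|.
Proof. by rewrite card_imfset //= ?cardE //; exact: val_inj. Qed.

Lemma vset_surj (s : {fset V}) : (s `<=` Vt)%fset -> exists sg, s = vset sg.
Proof.
move=> /fsubsetP sV; exists [set y : Y | val y \in s]%SET.
apply/fsetP => x; apply/idP/imfsetP => [xs|[y /=]]; last by rewrite inE => ? ->.
by exists (Sub x (sV x xs)) => //; rewrite !inE.
Qed.

Definition chambers : {set {set Y}} :=
  [set sg : {set Y} | `[< X (vset sg) >] && (#|sg| == l.+1)]%SET.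

Lemma card_chambers sg : sg \in chambers -> #|sg| = l.+1.
Proof. by rewrite inE => /andP[_ /eqP]. Qed.

Lemma chambersP s : X s -> #|` s| = l.+1 -> exists2 sg, sg \in chambers & s = vset sg.
Proof.
move=> Xs sl; have [|sg sE] := @vset_surj s.
  by apply/fsubsetP => x; exact: Vt_simplex.
by exists sg => //; rewrite inE -sE -card_vset -sE sl eqxx andbT; apply/asboolP.
Qed.

Lemma tau_chambers sg : sg \in chambers ->
  {in sg &, injective (fun y : Y => tau (val y))}.
Proof.
rewrite inE => /andP[/asboolP Xsg _] x y xsg ysg h.
by apply: val_inj; apply: (X_tau Xsg) h; rewrite in_vset.
Qed.

Definition vtuple n (s : n.-tuple Y) : n.-tuple V := [tuple of [seq val y | y <- s]].

Lemma tnth_vtuple n (s : n.-tuple Y) k : tnth (vtuple s) k = val (tnth s k).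
Proof. exact: tnth_map. Qed.

Lemma vtuple_inj n : injective (@vtuple n).
Proof.
move=> s t e; apply: eq_from_tnth => k; apply: val_inj.
by rewrite -!tnth_vtuple e.
Qed.

Lemma vtuple_reorder i (s : i.+1.-tuple Y) p : vtuple (reorder s p) = reorder (vtuple s) p.
Proof. by apply: eq_from_tnth => k; rewrite !(tnth_reorder, tnth_vtuple). Qed.

Lemma vtuple_omit n (s : n.+1.-tuple Y) j : vtuple (omit_nth s j) = omit_nth (vtuple s) j.
Proof. by apply: eq_from_tnth => k; rewrite !(tnth_mktuple, tnth_vtuple). Qed.

Lemma vtuple_cons n (y : Y) (s : n.-tuple Y) :
  vtuple [tuple of y :: s] = [tuple of val y :: vtuple s].
Proof.
apply: eq_from_tnth => k; rewrite tnth_vtuple.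
by case: (unliftP ord0 k) => [k' ->|->]; rewrite ?tnthS ?tnth0 // tnth_vtuple.
Qed.

Lemma uniq_vtuple n (s : n.-tuple Y) : uniq (vtuple s) = uniq s.
Proof.
by rewrite map_inj_uniq //; exact: val_inj.
Qed.

Definition support n (s : n.-tuple V) : {fset V} := [fset x in val s]%fset.

Lemma support_vset n (s : n.-tuple Y) sg :
  (support (vtuple s) `<=` vset sg)%fset = all (mem sg) s.
Proof.
apply/fsubsetP/all_tnthP => h.
  by move=> k; rewrite /= -in_vset; apply: h; rewrite inE /= -tnth_vtuple mem_tnth.
by move=> x; rewrite inE => /tnthP[k ->]; rewrite tnth_vtuple in_vset; exact: h.
Qed.

Lemma nchambers_weight n (s : n.+1.-tuple Y) :
  nchambers chambers s = weight X (support (vtuple s)).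
Proof.
rewrite /nchambers /weight dimension_eq.
set A := [set sg in chambers | _]%SET; set B := [set t | _].
have -> : fset_set B = [fset vset sg | sg in A]%fset.
  apply/fsetP => t; rewrite in_fset_set; last by apply: sub_finite_set X_fin => ? [].
  apply/idP/imfsetP => [/set_mem[Xt tl st]|[sg /=]].
    have [sg sgC tE] := chambersP Xt tl; exists sg => //=.
    by rewrite /A inE sgC /= -support_vset -tE.
  case/setIdP => sgC; rewrite -support_vset => ssg ->; apply/mem_set; split => //.
    by move: sgC; rewrite inE => /andP[/asboolP].
  by rewrite card_vset (card_chambers sgC).
by rewrite card_imfset //= ?cardE //; exact: vset_inj.
Qed.

Lemma support_neq0 n (s : n.+1.-tuple V) : support s != fset0.
Proof.
by apply/fset0Pn; exists (thead s); rewrite inE /= mem_tnth.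
Qed.

Lemma nchambers_simplex n (s : n.+1.-tuple Y) :
  (0 < nchambers chambers s)%N <-> X (support (vtuple s)).
Proof.
split=> [/card_gt0P[sg]|Xs].
  rewrite !inE -support_vset => /andP[/andP[/asboolP Xsg _] ssg].
  exact: X_sub Xsg ssg (support_neq0 _).
have [t [Xt st tl]] := X_pure Xs.
have [sg sgC tE] := chambersP Xt tl.
by apply: (nchambers_gt0 sgC); rewrite -support_vset -tE.
Qed.

Lemma simplex_vtuple n (s : n.+1.-tuple V) : X (support s) -> exists s', s = vtuple s'.
Proof.
move=> Xs.
have h k : tnth s k \in Vt by apply: (Vt_simplex Xs); rewrite inE /= mem_tnth.
exists [tuple Sub (tnth s k) (h k) : Y | k < n.+1].
by apply: eq_from_tnth => k; rewrite tnth_vtuple tnth_mktuple.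
Qed.

Lemma ordered_simplexP n (s : n.+1.-tuple Y) :
  ordered_simplex X (vtuple s) <-> uniq s /\ (0 < nchambers chambers s)%N.
Proof. by rewrite nchambers_simplex /ordered_simplex uniq_vtuple. Qed.

Local Notation pull f := (fun s => f (vtuple s)).

Lemma pull_cochain i (f : i.+1.-tuple V -> R) : cochain X f ->
  is_cochain chambers (pull f).
Proof.
move=> [f0 falt]; split=> [s p|s s0]; first by rewrite vtuple_reorder falt.
by apply: f0 => /ordered_simplexP[_]; rewrite s0.
Qed.

Lemma fsbig_vertices (A : set V) (F : V -> R) : A `<=` [set` Vt] ->
  \sum_(v \in A) F v = \sum_(y : Y | `[< A (val y) >]) F (val y).
Proof.
move=> AV; have Af : finite_set A by apply: sub_finite_set AV (finite_fset _).
rewrite fsbig_finite //= -(big_seq_fsetE _ Vt (fun v => `[< A v >])) /=.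
rewrite -[RHS]big_filter; apply: perm_big; apply: uniq_perm.
- exact: fset_uniq.
- exact/filter_uniq/fset_uniq.
move=> v; rewrite in_fset_set // mem_filter; apply/idP/andP => [/set_mem Av|[/asboolP Av _]].
  by split; [apply/asboolP | exact: AV].
exact/mem_set.
Qed.

(** The factor [nchambers chambers s] cancels the denominators. Writing the weight of [y :: s] as a
    count of chambers and exchanging the sums leaves, in each chamber containing [s], the sum over
    all its vertices [y]. *)
Lemma laplace_vtuple i (f : i.+1.-tuple V -> R) (s : i.+1.-tuple Y) :
  cochain X f -> ordered_simplex X (vtuple s) ->
  (nchambers chambers s)%:R * laplace X f (vtuple s) =
  weighted_laplace chambers l.+1 (pull f) s.
Proof.
move=> fc os; have [galt _] := pull_cochain fc.
have [us s0] := (ordered_simplexP s).1 os.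
rewrite /laplace /codifferential fsbig_vertices; last first.
  move=> v /= [_ Xv]; apply: (Vt_simplex Xv).
  by rewrite inE /= inE eqxx.
rewrite mulr_sumr.
transitivity (\sum_y (nchambers chambers [tuple of y :: s])%:R *
    dsum (pull f) [tuple of y :: s]).
  rewrite big_mkcond; apply: eq_bigr => y _.
  rewrite -[X in `[< X >]]/(ordered_simplex X [tuple of val y :: vtuple s]).
  (* The terms missing from the codifferential vanish: either [y :: s] has a repeated entry, where
     [dsum] is 0, or it lies in no chamber. *)
  rewrite -vtuple_cons; case: asboolP => [oys|noys]; last first.
    have [uys|/(alternating_repeated (dsum_alternating galt)) ->] :=
      boolP (uniq [tuple of y :: s]); last by rewrite mulr0.
    have [ys0|] := posnP (nchambers chambers [tuple of y :: s]).
      by rewrite ys0 mul0r.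
    by move=> ys; case: noys; apply/ordered_simplexP.
  have -> : [fset x in val y :: val (vtuple s)]%fset =
    support (vtuple [tuple of y :: s]) by [].
  rewrite -!nchambers_weight mulrA mulrCA mulfV ?mulr1; last first.
    by rewrite pnatr_eq0 -lt0n.
  congr (_ * _); rewrite /coboundary asboolT //.
  by apply: eq_bigr => j _; rewrite vtuple_omit.
transitivity (\sum_(sg in chambers | all (mem sg) s)
    \sum_(y in sg) dsum (pull f) [tuple of y :: s]).
  under eq_bigr => y _ do rewrite nchambers_sum mulr_suml.
  rewrite (exchange_big_dep (fun sg => (sg \in chambers) && all (mem sg) s)) /=.
    apply: eq_bigr => sg /andP[sgC hs].
    apply: eq_big => [y|y _]; last by rewrite mul1r.
    by rewrite sgC hs andbT.
  by move=> y sg _ /andP[-> /andP[_ ->]].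
by apply: eq_bigr => sg /andP[sgC _]; rewrite (local_laplace_dsum card_chambers).
Qed.

Lemma laplace_eigenvalueP i (a : R) : laplace_eigenvalue X i a <->
  exists g : i.+1.-tuple Y -> R, eigenfunction chambers l.+1 a g.
Proof.
split=> [[f [fc f0 hf]]|[g [gc [s0 g0] hg]]].
  have gc := pull_cochain fc.
  exists (pull f); split => //.
    have [s fs] : exists s, f s != 0.
      apply: contrapT => nf; apply: f0; apply: funext => s.
      by apply/eqP; apply: contrapT => fs; apply: nf; exists s; exact/negP.
    have [|s' sE] := @simplex_vtuple _ s; last by exists s'; rewrite -sE.
    by apply: contrapT => no; have [h _] := fc; rewrite h ?eqxx // in fs; case.
  move=> s; have [os|nos] := pselect (ordered_simplex X (vtuple s)).
    by rewrite -laplace_vtuple // hf mulrCA mulrA.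
  have [h _] := fc; rewrite (h _ nos) mulr0.
  have [walt w0] := weighted_laplace_cochain card_chambers gc.1.
  have [us|/(alternating_repeated walt)//] := boolP (uniq s).
  have [/w0//|s0] := posnP (nchambers chambers s).
  by case: nos; apply/ordered_simplexP.
(* The extension of [g] by 0: as [vtuple] is injective, the sum has at most one term. *)
pose f (s : i.+1.-tuple V) := \sum_(t | vtuple t == s) g t.
have fE t : f (vtuple t) = g t.
  rewrite /f (big_pred1 t) // => t' /=.
  by rewrite (inj_eq (@vtuple_inj _)).
have f_notin s : (forall t, s <> vtuple t) -> f s = 0.
  by move=> h; rewrite /f big1 // => t /eqP /esym /h.
have gE : pull f = g by apply: funext => t; exact: fE.
have fc : cochain X f.
  split=> [s nos|s p].
    have [[t st]|nt] := pselect (exists t, s = vtuple t); last first.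
      by apply: f_notin => t st; apply: nt; exists t.
    rewrite st fE; have [galt g0'] := gc.
    have [ut|/(alternating_repeated galt)//] := boolP (uniq t).
    have [/g0'//|t0] := posnP (nchambers chambers t).
    by case: nos; rewrite st; apply/ordered_simplexP.
  have [[t ->]|nt] := pselect (exists t, s = vtuple t).
    by rewrite -vtuple_reorder !fE; case: gc => galt _; rewrite galt.
  rewrite !f_notin ?mulr0 // => t st; apply: nt; first by exists t.
  exists (reorder t p^-1%g); rewrite vtuple_reorder -st.
  by rewrite reorderM mulVg reorder1.
exists f; split => //.
  by move=> /(congr1 (@^~ (vtuple s0))) /=; rewrite fE => /eqP; apply/negP.
apply: funext => s; have [os|nos] := pselect (ordered_simplex X s); last first.
  have [-> // _] := fc; rewrite mulr0 /laplace /codifferential fsbig1 // => v.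
  rewrite /= => -[uvs Xvs]; case: nos; split.
    by move: uvs => /= /andP[].
  apply: X_sub Xvs _ (support_neq0 s).
  by apply/fsubsetP => x; rewrite !inE => /= ->; rewrite orbT.
have [t st] := simplex_vtuple os.2; rewrite st in os *.
have [_ t0] := (ordered_simplexP t).1 os.
have n0 : (nchambers chambers t)%:R != 0 :> R by rewrite pnatr_eq0 -lt0n.
apply: (mulfI n0); rewrite laplace_vtuple // gE hg fE.
by rewrite mulrCA mulrA.
Qed.

Section EigenvalueBounds.
Variables (i : nat) (J : 'I_i.+1 -> 'I_l.+1) (Z : set (i.+1.-tuple V)).
Variables (eps : i.+1.-tuple V -> R) (phi : 'I_i.+1 -> i.+1.-tuple V -> i.+1.-tuple V).
Variables (y0 : V) (s0 : i.+1.-tuple V).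
Hypothesis i_lt : (i < l)%N.
Hypothesis J_inj : injective J.
Hypothesis Z_type : forall s, Z s -> forall k, tau (tnth s k) = J k.
Hypothesis Z_cone : forall s, Z s -> X (support [tuple of y0 :: s]).
Hypothesis phiZ : forall j s, Z s -> Z (phi j s).
Hypothesis phiK : forall j s, Z s -> phi j (phi j s) = s.
Hypothesis phi_omit : forall j s, Z s -> omit_nth (phi j s) j = omit_nth s j.
Hypothesis phi_eps : forall j s, Z s -> eps (phi j s) = - eps s.
Hypotheses (s0Z : Z s0) (s0eps : eps s0 != 0).

Lemma eigenvalue_bounds_of_cycle : exists M m : R,
  [/\ max_eigenvalue X i M, min_nonzero_eigenvalue X i m,
      M = l.+1%:R & m <= (l - i)%N%:R].
Proof.
have chne : chambers != finset.set0.
  have [s /X_pure[t [Xt _ tl]]] := X_ne.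
  by have [sg sgC _] := chambersP Xt tl; apply/set0Pn; exists sg.
have maxE := type_cochain_eigenfunction R card_chambers tau_chambers (n := i) i_lt chne.
have Z_X s : Z s -> X (support s).
  move=> /Z_cone Xs; apply: X_sub Xs _ (support_neq0 _).
  by apply/fsubsetP => x; rewrite !inE => /= ->; rewrite orbT.
have y0V : y0 \in Vt by apply: (Vt_simplex (Z_cone s0Z)); rewrite !inE eqxx.
pose y : Y := Sub y0 y0V.
pose Z' := [set s : i.+1.-tuple Y | `[< Z (vtuple s) >]]%SET.
(* The default [s] is not reached on [Z']: [phi j] preserves [Z], whose tuples have their vertices
   in [Vt]. *)
pose phi' j (s : i.+1.-tuple Y) := odflt s [pick t | vtuple t == phi j (vtuple s)].
have Z'P s : s \in Z' -> Z (vtuple s) by rewrite inE => /asboolP.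
have phi'E j s : s \in Z' -> vtuple (phi' j s) = phi j (vtuple s).
  move=> /Z'P /(phiZ j) /Z_X /simplex_vtuple[t tE]; rewrite /phi'.
  by case: pickP => [t' /eqP //|/(_ t)]; rewrite tE eqxx.
have [s0' s0E] := simplex_vtuple (Z_X _ s0Z).
have phi'Z j s : s \in Z' -> phi' j s \in Z'.
  by move=> sZ; rewrite inE phi'E //; apply/asboolP/phiZ/Z'P.
have [] := @min_eigenvalue_of_cycle R Y chambers l.+1 card_chambers _ tau_chambers i
  J Z' (fun s => eps (vtuple s)) phi' y J_inj _ _ phi'Z _ _ _ s0'.
- by move=> s sZ k; rewrite -tnth_vtuple; apply: Z_type; exact: Z'P.
- move=> s /Z'P /Z_cone Xs; have [t [Xt st tl]] := X_pure Xs.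
  have [sg sgC tE] := chambersP Xt tl; exists sg => //.
  by rewrite -support_vset -tE vtuple_cons.
- move=> j s sZ; apply: vtuple_inj; rewrite !phi'E ?phi'Z //.
  by apply: phiK; exact: Z'P.
- move=> j s sZ; apply: vtuple_inj; rewrite !vtuple_omit phi'E //.
  by apply: phi_omit; exact: Z'P.
- by move=> j s sZ; rewrite phi'E //; apply: phi_eps; exact: Z'P.
- by rewrite inE -s0E; apply/asboolP.
- by rewrite -s0E.
move=> m [mE m0 mle mmin]; exists l.+1%:R, m; split => //.
- split; first by apply/laplace_eigenvalueP; eexists; exact: maxE.
  by move=> a /laplace_eigenvalueP[f]; exact: eigenfunction_le.
- split => //; first exact/laplace_eigenvalueP.
  by move=> a /laplace_eigenvalueP[f hf]; exact: mmin hf.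
(* There are [l.+1] types and [i.+1] vertices, and the two successors cancel. *)
- rewrite natrB ?(ltnW i_lt) //; move: mle.
  by rewrite -addn1 -(addn1 i) !natrD opprD addrACA subrr addr0.
Qed.

End EigenvalueBounds.

End Transfer.

(** * The Tits system *)

(* [generated] also names the subgroup generated in a finite group. *)
Local Notation generated := Defs.generated.

Section MatrixGroups.
Variables (F : fieldType) (N : nat).
Implicit Types (A H S : set 'M[F]_N) (g : 'M[F]_N).

Lemma invmxM g h : g \in unitmx -> h \in unitmx -> invmx (g *m h) = invmx h *m invmx g.
Proof.
move=> gu hu; have ghu : g *m h \in unitmx by rewrite unitmx_mul gu.
apply: (can_inj (mulKmx ghu)).
by rewrite mulmxV // !mulmxA mulmxK // mulmxV.
Qed.

Lemma unitmx_subgroup : is_subgroup [set g : 'M[F]_N | g \in unitmx].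
Proof.
split=> //= [|g h gu hu|g]; first exact: unitmx1.
  by rewrite unitmx_mul gu.
by rewrite unitmx_inv.
Qed.

Lemma sub_generated A : A `<=` generated A.
Proof. by move=> g Ag H _; exact. Qed.

Lemma generated_subgroup A : A `<=` [set g | g \in unitmx] -> is_subgroup (generated A).
Proof.
move=> Au; split.
- by move=> g; apply; [exact: unitmx_subgroup | exact: Au].
- by move=> H [].
- by move=> g h hg hh H Hg AH; have [_ _ m _] := Hg; apply: m; [exact: hg | exact: hh].
- by move=> g hg H Hg AH; have [_ _ _ m] := Hg; apply: m; exact: hg.
Qed.

(** The matrices [h] such that left multiplication by [h] and by its inverse preserves [S] form a
    subgroup [Q], to which the definition of [generated] applies. *)
Lemma generated_ind A S : A `<=` [set g | g \in unitmx] -> S 1%:M ->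
  (forall a s, A a -> S s -> S (a *m s)) ->
  (forall a s, A a -> S s -> S (invmx a *m s)) -> generated A `<=` S.
Proof.
move=> Au S1 Sm Si g.
pose Q := [set h : 'M[F]_N | [/\ h \in unitmx,
  forall s, S s -> S (h *m s) & forall s, S s -> S (invmx h *m s)]].
move=> /(_ Q) [].
- split=> [h []//| |h k [hu h1 h2] [ku k1 k2]|h [hu h1 h2]].
  + by split=> [|s|s]; rewrite ?unitmx1 ?invmx1 ?mul1mx.
  + split=> [|s Ss|s Ss]; first by rewrite unitmx_mul hu.
      by rewrite -mulmxA; apply/h1/k1.
    by rewrite invmxM // -mulmxA; apply/k2/h2.
  + by split=> //; rewrite ?unitmx_inv ?invmxK.
- by move=> a Aa; split; [exact: Au | move=> s; exact: Sm | move=> s; exact: Si].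
- by move=> gu /(_ _ S1); rewrite mulmx1.
Qed.

Lemma left_cosetP g h H : is_subgroup H -> g \in unitmx -> h \in unitmx ->
  left_coset g H = left_coset h H <-> H (invmx g *m h).
Proof.
move=> [Hu H1 Hm Hi] gu hu; split=> [e|Hgh].
  have : left_coset g H h by rewrite e; exists 1%:M => //; rewrite mulmx1.
  by case=> k Hk <-; rewrite mulKmx.
apply/seteqP; split=> _ [k Hk <-].
  exists (invmx (invmx g *m h) *m k); first by apply: Hm => //; apply: Hi.
  by rewrite invmxM ?unitmx_inv // invmxK !mulmxA mulmxV // mul1mx.
exists (invmx g *m h *m k); first exact: Hm.
by rewrite !mulmxA mulmxV // mul1mx.
Qed.

Lemma left_coset_subgroup_eq g h H K : is_subgroup H -> is_subgroup K ->
  g \in unitmx -> h \in unitmx ->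
  left_coset g H = left_coset h K -> H `<=` K.
Proof.
move=> [Hu H1 Hm Hi] [Ku K1 Km Ki] gu hu e.
have : left_coset h K g by rewrite -e; exists 1%:M => //; rewrite mulmx1.
case=> p Kp gE y Hy.
have : left_coset h K (g *m y) by rewrite -e; exists y.
case=> p' Kp'; rewrite -gE -mulmxA => /(can_inj (mulKmx hu)) p'E.
have -> : y = invmx p *m p' by rewrite p'E mulKmx //; exact: Ku.
by apply: Km => //; exact: Ki.
Qed.

End MatrixGroups.

Section GroupPoints.
Variables (K : fieldType) (L : closedFieldType) (iota : {rmorphism K -> L}) (N : nat).
Variable G : set 'M[L]_N.
Hypothesis G_simple : almost_simple iota G.

Lemma Gplus_generators_unit : [set g | exists (h : 'M[K]_N) (a : 'M[int]_(N, 1)),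
    [/\ h \in unitmx, torus iota h a `<=` G & unipotent_radical_points iota G h a g]]
  `<=` [set g | g \in unitmx].
Proof.
move=> g [h [a [_ _ [Gg _]]]] /=.
have [[[[Gu _ _ _] _] _ _] _ _ _] := G_simple.
by have /= := Gu _ Gg; rewrite map_unitmx.
Qed.

Lemma Gplus_subgroup : is_subgroup (Gplus iota G).
Proof. exact/generated_subgroup/Gplus_generators_unit. Qed.

End GroupPoints.

(** * Bruhat decomposition and parahoric subgroups *)

Section TitsSystem.
Variables (R : realType) (K : TopologicalField.type) (nu : K -> R).
Variables (L : closedFieldType) (iota : {rmorphism K -> L}) (N : nat).
Variables (G : set 'M[L]_N) (r : nat).
Hypothesis G_simple : almost_simple iota G.
Variable T : bruhat_tits_system nu iota G r.

Local Notation Gp := (Gplus iota G).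
Local Notation B := (bt_B T).
Local Notation W := (bt_N T).
Local Notation H := (bt_B T `&` bt_N T).
Local Notation s := (bt_s T).

Lemma Gp_unit g : Gp g -> g \in unitmx.
Proof. by have [h _ _ _] := Gplus_subgroup G_simple; exact: h. Qed.

Lemma W_Gp g : W g -> Gp g. Proof. by case. Qed.

Lemma W_unit g : W g -> g \in unitmx. Proof. by move=> /W_Gp/Gp_unit. Qed.

Lemma B_unit g : B g -> g \in unitmx.
Proof. by have [h _ _ _] := bt_B_group T; exact: h. Qed.

Lemma B1 : B 1%:M. Proof. by case: (bt_B_group T). Qed.

Lemma BM g h : B g -> B h -> B (g *m h).
Proof. by case: (bt_B_group T) => _ _ m _; exact: m. Qed.

Lemma BV g : B g -> B (invmx g).
Proof. by case: (bt_B_group T) => _ _ _; exact. Qed.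

Lemma W_subgroup : is_subgroup W.
Proof.
rewrite -(bt_s_generate T); apply: generated_subgroup => g [[j _ <-]|[/B_unit //]].
exact/W_unit/bt_s_N.
Qed.

Lemma W1 : W 1%:M. Proof. by case: W_subgroup. Qed.

Lemma WM g h : W g -> W h -> W (g *m h).
Proof. by case: W_subgroup => _ _ m _; exact: m. Qed.

Lemma WV g : W g -> W (invmx g).
Proof. by case: W_subgroup => _ _ _; exact. Qed.

Lemma HM g h : H g -> H h -> H (g *m h).
Proof. by move=> [? ?] [? ?]; split; [exact: BM | exact: WM]. Qed.

Lemma HV g : H g -> H (invmx g).
Proof. by move=> [? ?]; split; [exact: BV | exact: WV]. Qed.

Lemma H1 : H 1%:M. Proof. by split; [exact: B1 | exact: W1]. Qed.

Lemma H_conj g h : W g -> H h -> H (g *m h *m invmx g).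
Proof. by move=> Wg Hh; rewrite -(bt_normal Wg); exists h. Qed.

Lemma H_conjV g h : W g -> H h -> H (invmx g *m h *m g).
Proof.
move=> Wg Hh; have := H_conj (WV Wg) Hh.
by rewrite invmxK.
Qed.

Lemma sW j : W (s j). Proof. exact: bt_s_N. Qed.

Lemma s_unit j : s j \in unitmx. Proof. exact/W_unit/sW. Qed.

Lemma ss_H j : H (s j *m s j).
Proof. by split; [case: (bt_s_order2 T j) | apply: WM; exact: sW]. Qed.

Lemma s_inv j : exists2 h, H h & invmx (s j) = h *m s j.
Proof.
exists (invmx (s j *m s j)); first exact/HV/ss_H.
by rewrite invmxM ?s_unit // mulmxKV // s_unit.
Qed.

Definition word (u : seq 'I_r.+1) : 'M[K]_N := foldr (fun j g => s j *m g) 1%:M u.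

Lemma word_W u : W (word u).
Proof. by elim: u => [|j u IH] /=; [exact: W1 | apply: WM => //; exact: sW]. Qed.

Lemma word_cat u v : word (u ++ v) = word u *m word v.
Proof. by elim: u => [|j u IH] /=; rewrite ?mul1mx // IH mulmxA. Qed.

(** The preimage in [bt_N] of the subgroup of the affine Weyl group generated by the reflections of
    [J]. *)
Definition words (J : pred 'I_r.+1) : set 'M[K]_N :=
  [set n | exists u h, [/\ all J u, H h & n = word u *m h]].

Lemma words_W J n : words J n -> W n.
Proof. by move=> [u [h [_ [_ Wh] ->]]]; apply: WM => //; exact: word_W. Qed.

Lemma words1 J : words J 1%:M.
Proof. by exists [::], 1%:M; split=> //; [exact: H1 | rewrite mulmx1]. Qed.

Lemma words_mulH J n h : words J n -> H h -> words J (n *m h).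
Proof.
move=> [u [h' [uJ Hh' ->]]] Hh; exists u, (h' *m h).
by rewrite mulmxA; split => //; exact: HM.
Qed.

Lemma words_Hmul J n h : H h -> words J n -> words J (h *m n).
Proof.
move=> Hh nJ; have Wn := words_W nJ.
have -> : h *m n = n *m (invmx n *m h *m n).
  by rewrite !mulmxA mulmxV ?mul1mx //; exact: W_unit.
by apply: words_mulH => //; exact: H_conjV.
Qed.

Lemma words_smul (J : pred 'I_r.+1) n j : J j -> words J n -> words J (s j *m n).
Proof.
by move=> Jj [u [h [uJ Hh ->]]]; exists (j :: u), h; rewrite /= Jj mulmxA.
Qed.

Lemma words_muls (J : pred 'I_r.+1) n j : J j -> words J n -> words J (n *m s j).
Proof.
move=> Jj [u [h [uJ Hh ->]]].
exists (rcons u j), (invmx (s j) *m h *m s j); split; first by rewrite all_rcons Jj.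
  exact: H_conjV (sW j) Hh.
rewrite -cats1 word_cat /= mulmx1 !mulmxA.
by rewrite mulmxK // s_unit.
Qed.

Lemma words_predT : W `<=` words predT.
Proof.
rewrite -(bt_s_generate T); apply: generated_ind.
- by move=> g [[j _ <-]|[/B_unit //]]; exact: s_unit.
- exact: words1.
- by move=> g n [[j _ <-]|Hg] nW; [exact: words_smul | exact: words_Hmul].
- move=> g n [[j _ <-]|Hg] nW; last by apply: words_Hmul => //; exact: HV.
  have [h Hh ->] := s_inv j; rewrite -mulmxA; apply: words_Hmul => //.
  exact: words_smul.
Qed.

Local Notation dc := (double_coset B).

Lemma dc_refl g : dc g g.
Proof. by exists 1%:M, 1%:M; rewrite mul1mx mulmx1; split => //; exact: B1. Qed.

Lemma dc_sym g h : dc g h -> dc h g.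
Proof.
move=> [b [c [Bb Bc ->]]]; exists (invmx b), (invmx c); split; try exact: BV.
by rewrite !mulmxA mulVmx ?B_unit // mul1mx mulmxK // B_unit.
Qed.

Lemma dc_mull g h b : B b -> dc g h -> dc g (b *m h).
Proof.
move=> Bb [b' [c [Bb' Bc ->]]]; exists (b *m b'), c; rewrite !mulmxA; split=> //.
exact: BM.
Qed.

Lemma dc_mulr g h b : B b -> dc g h -> dc g (h *m b).
Proof.
move=> Bb [b' [c [Bb' Bc ->]]]; exists b', (c *m b); rewrite !mulmxA; split=> //.
exact: BM.
Qed.

(* Induction on the length of a word: a Weyl element that no shorter word
   represents lies in the double coset of a word only if the word represents it. *)
Lemma double_coset_word u n : W n ->
  (forall v h, H h -> n = word v *m h -> (size u <= size v)%N) ->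
  dc (word u) n -> exists2 h, H h & n = word u *m h.
Proof.
elim: u n => [|j u IH] n Wn nmin /=.
  move=> [b [c [Bb Bc nE]]]; exists n; last by rewrite mul1mx.
  by split=> //; rewrite nE mulmx1; exact: BM.
move=> [b [c [Bb Bc nE]]]; have [h Hh sV] := s_inv j.
have wE : word u = h *m (s j *m invmx b *m n) *m invmx c.
  rewrite mulmxA mulmxA -sV nE !mulmxA mulmxKV ?B_unit //.
  by rewrite mulVmx ?s_unit // mul1mx mulmxK // B_unit.
(* The exchange axiom leaves two cases. In the first, [u] would represent [n], against minimality;
   in the second, induction shows that [u] represents [s j *m n], hence [j :: u] represents [n]. *)
have [nw|snw] : dc (word u) n \/ dc (word u) (s j *m n).
  have [e|e] := bt_exchange j Wn (BV Bb); [left|right]; apply: dc_sym; rewrite wE.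
    by apply: dc_mulr; [exact: BV | apply: dc_mull e; case: Hh].
  by apply: dc_mulr; [exact: BV | apply: dc_mull e; case: Hh].
  have [|h' Hh' nE'] := IH n Wn _ nw.
    by move=> v h' Hh' /(nmin _ _ Hh') /= /ltnW.
  by have := nmin _ _ Hh' nE'; rewrite /= ltnn.
have sback m : s j *m n = m -> n = h *m s j *m m.
  by move=> <-; rewrite -sV mulKmx // s_unit.
have [|h' Hh' nE'] := IH (s j *m n) (WM (sW j) Wn) _ snw.
  move=> v h' Hh' /sback nE'.
  have [v' [h'' [v'v Hh'' nE'']]] : exists v' h'', [/\ size v' = (size v).+1, H h'' &
      n = word v' *m h''].
    exists (j :: v), (invmx (word (j :: v)) *m h *m word (j :: v) *m h'); split => //.
      by apply: HM => //; apply: H_conjV => //; exact: word_W.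
    by rewrite nE' !mulmxA mulmxV ?mul1mx ?mulmxA //; exact/W_unit/word_W.
  by have := nmin _ _ Hh'' nE''; rewrite v'v.
exists (invmx (word (j :: u)) *m h *m word (j :: u) *m h').
  by apply: HM => //; apply: H_conjV => //; exact: word_W.
have -> : n = h *m (word (j :: u) *m h') by rewrite (sback _ nE') /= !mulmxA.
rewrite -[s j *m word u]/(word (j :: u)) !mulmxA mulmxV ?mul1mx //.
exact/W_unit/word_W.
Qed.

Lemma min_word n : W n -> exists u h, [/\ H h, n = word u *m h &
  forall v h', H h' -> n = word v *m h' -> (size u <= size v)%N].
Proof.
move=> /words_predT [u0 [h0 [_ Hh0 nE0]]].
pose P d := `[< exists u h, [/\ H h, n = word u *m h & size u = d] >].
have exP : exists d, P d by exists (size u0); apply/asboolP; exists u0, h0.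
case: (ex_minnP exP) => d /asboolP[u [h [Hh nE sE]]] dmin.
exists u, h; split => // v h' Hh' nE'; rewrite sE; apply: dmin.
by apply/asboolP; exists v, h'.
Qed.

(** Of the minimal words of [n] and [n'], take the shorter one: no word of the other element is
    shorter, so [double_coset_word] applies. *)
Lemma double_coset_inj n n' : W n -> W n' -> dc n' n -> exists2 h, H h & n = n' *m h.
Proof.
move=> Wn Wn' nn'; have [u [h [Hh nE umin]]] := min_word Wn.
have [u' [h' [Hh' nE' umin']]] := min_word Wn'.
have [Bh Wh] := Hh; have [Bh' Wh'] := Hh'.
have hu : h \in unitmx by exact: W_unit.
have hu' : h' \in unitmx by exact: W_unit.
case/orP: (leq_total (size u') (size u)) => su.
  have [||k Hk nk] := @double_coset_word u' n Wn.
  - by move=> v k Hk /(umin _ _ Hk); exact: leq_trans.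
  - apply/dc_sym; have -> : word u' = n' *m invmx h' by rewrite nE' mulmxK.
    by apply: dc_mulr; [exact: BV | exact: dc_sym].
  exists (invmx h' *m k); first by apply: HM => //; exact: HV.
  by rewrite mulmxA nE' mulmxK.
have [||k Hk nk] := @double_coset_word u n' Wn'.
- by move=> v k Hk /(umin' _ _ Hk); exact: leq_trans.
- apply/dc_sym; have -> : word u = n *m invmx h by rewrite nE mulmxK.
  by apply: dc_mulr; [exact: BV | exact: nn'].
exists (invmx k *m h); first by apply: HM => //; exact: HV.
by rewrite mulmxA nk mulmxK // -?nE //; case: Hk => /B_unit.
Qed.

Local Notation P J := (parahoric T J).

Lemma parahoric_gen_unit (J : {set 'I_r.+1}) :
  B `|` [set s j | j in [set j | j \in J]] `<=` [set g | g \in unitmx].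
Proof. by move=> g [/B_unit //|[j _ <-]]; exact: s_unit. Qed.

Lemma parahoric_subgroup J : is_subgroup (P J).
Proof. exact/generated_subgroup/parahoric_gen_unit. Qed.

Lemma parahoricM J g h : P J g -> P J h -> P J (g *m h).
Proof. by have [_ _ m _] := parahoric_subgroup J; exact: m. Qed.

Lemma parahoric_B J : B `<=` P J.
Proof. by move=> b Bb; apply: sub_generated; left. Qed.

Lemma parahoric_s (J : {set 'I_r.+1}) j : j \in J -> P J (s j).
Proof. by move=> jJ; apply: sub_generated; right; exists j. Qed.

Lemma parahoric_words (J J' : {set 'I_r.+1}) :
  {subset J' <= J} -> words (mem J') `<=` P J.
Proof.
move=> JJ _ [u [h [uJ [Bh _] ->]]]; apply: parahoricM; last exact: parahoric_B.
elim: u uJ => [_|j u IH /= /andP[jJ uJ]]; first by apply: parahoric_B; exact: B1.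
by apply: parahoricM; [by apply: parahoric_s; exact: JJ | exact: IH].
Qed.

(** By the exchange axiom, the union of the double cosets of words in [J] is stable under left
    multiplication by the generators and their inverses. *)
Lemma parahoric_double_coset (J : {set 'I_r.+1}) g : P J g ->
  exists2 n, words (mem J) n & dc n g.
Proof.
move: g; apply: (@generated_ind _ _ _
  [set g | exists2 n, words (mem J) n & dc n g] (@parahoric_gen_unit J)) => /=.
- by exists 1%:M; [exact: words1 | exact: dc_refl].
- move=> a g [Ba|[j jJ <-]] [n nJ ng]; first by exists n => //; exact: dc_mull.
  have [b [c [Bb Bc ->]]] := ng.
  case: (bt_exchange j (words_W nJ) Bb) => e; [exists n => //|exists (s j *m n)].
  + by rewrite !mulmxA; apply: dc_mulr.
  + exact: words_smul.
  + by rewrite !mulmxA; apply: dc_mulr.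
- move=> a g [Ba|[j jJ <-]] [n nJ ng].
    by exists n => //; apply: dc_mull => //; exact: BV.
  have [b [c [Bb Bc ->]]] := ng; have [h [Bh _] ->] := s_inv j.
  rewrite -(mulmxA h).
  case: (bt_exchange j (words_W nJ) Bb) => e; [exists n => //|exists (s j *m n)].
  + by apply: dc_mull => //; rewrite !mulmxA; apply: dc_mulr.
  + exact: words_smul.
  + by apply: dc_mull => //; rewrite !mulmxA; apply: dc_mulr.
Qed.

Lemma parahoric_W (J : {set 'I_r.+1}) n : W n -> P J n -> words (mem J) n.
Proof.
move=> Wn /parahoric_double_coset[n' n'J nn'].
have [h Hh ->] := double_coset_inj Wn (words_W n'J) nn'.
exact: words_mulH.
Qed.

End TitsSystem.

(** * The apartment *)

Section Apartment.
Variables (R : realType) (K : TopologicalField.type) (nu : K -> R).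
Variables (L : closedFieldType) (iota : {rmorphism K -> L}) (N : nat).
Variables (G : set 'M[L]_N) (r : nat).
Hypothesis G_simple : almost_simple iota G.
Variable T : bruhat_tits_system nu iota G r.

Local Notation Gp := (Gplus iota G).
Local Notation B := (bt_B T).
Local Notation W := (bt_N T).
Local Notation H := (bt_B T `&` bt_N T).
Local Notation s := (bt_s T).
Local Notation act := (bt_act T).
Local Notation vx := (bt_x T).
Local Notation words J := (words T J).
Local Notation P J := (parahoric T J).

Lemma act_H h y : H h -> act h y = y.
Proof. by move=> [Bh Wh]; apply: bt_act_ker. Qed.

Lemma act1 y : act 1%:M y = y.
Proof. exact/act_H/H1. Qed.

Lemma actVK g y : W g -> act (invmx g) (act g y) = y.
Proof.
move=> Wg; rewrite -bt_act_mul //; last exact: WV.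
by rewrite mulVmx ?act1 //; exact: (W_unit G_simple Wg).
Qed.

Lemma act_affine_comb n (I : finType) (c : I -> R) (y : I -> 'rV[R]_r) : W n ->
  \sum_k c k = 1 -> act n (\sum_k c k *: y k) = \sum_k c k *: act n (y k).
Proof.
move=> Wn c1; have [A [b nE]] := bt_act_affine Wn.
under [RHS]eq_bigr do rewrite nE scalerDr.
rewrite big_split /= -scaler_suml c1 scale1r nE mulmx_suml; congr (_ + _).
by apply: eq_bigr => k _; rewrite scalemxAl.
Qed.

(** The barycentre of the vertices lies in the open alcove and is fixed, so [bt_act_alcove]
    applies. *)
Lemma act_fix_B n : W n -> (forall k, act n (vx k) = vx k) -> B n.
Proof.
move=> Wn hn; pose c : R := r.+1%:R^-1; pose y := \sum_k c *: vx k.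
have c0 : r.+1%:R != 0 :> R by rewrite pnatr_eq0.
have c1 : \sum_(k < r.+1) c = 1 by rewrite sumr_const card_ord -mulr_natl mulfV.
have ya : bt_alcove T y.
  by exists (fun=> c); split => // k; rewrite invr_gt0 ltr0n.
apply: (bt_act_alcove Wn ya).
rewrite /y act_affine_comb // (_ : \sum_k _ = y) //.
by apply: eq_bigr => k _; rewrite hn.
Qed.

Lemma act_words J n k : ~~ J k -> words J n -> act n (vx k) = vx k.
Proof.
move=> Jk [u [h [uJ Hh ->]]]; have Wh := Hh.2.
rewrite bt_act_mul ?(act_H _ Hh) //; last exact: word_W.
elim: u uJ => [_|j u IH /= /andP[jJ uJ]]; first exact: act1.
rewrite bt_act_mul ?IH //; [|exact: sW|exact: word_W].
by apply: bt_s_reflection; apply: contraNneq Jk => ->.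
Qed.

Lemma act_parahoric (J : {set 'I_r.+1}) n k : k \notin J -> W n -> P J n ->
  act n (vx k) = vx k.
Proof. by move=> kJ Wn /(parahoric_W G_simple Wn); apply: act_words. Qed.

Definition vertex (g : 'M[K]_N) (j : 'I_r.+1) : set 'M[K]_N :=
  left_coset g (P (~: [set j])%SET).

(** Equal cosets have nested subgroups. If [j] and [k] differed, [s j] would lie in the parahoric of
    type [~: [set j]] and fix [bt_x T j] too, hence the whole alcove, although it is not in
    [bt_B]. *)
Lemma vertex_type_inj g h j k : g \in unitmx -> h \in unitmx ->
  vertex g j = vertex h k -> j = k.
Proof.
move=> gu hu e; apply/eqP; apply: contrapT => /negP jk.
have [nB _] := bt_s_order2 T j; apply: nB; apply: act_fix_B; first exact: sW.
have Pk : P (~: [set k])%SET (s j).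
  by apply: parahoric_s; rewrite !inE.
have Pj : P (~: [set j])%SET (s j).
  apply: (left_coset_subgroup_eq _ _ hu gu (esym e)) => //; exact: parahoric_subgroup.
move=> m; have [->|mj] := eqVneq m j.
  by apply: (act_parahoric _ _ Pj); [rewrite !inE eqxx | exact: sW].
exact: bt_s_reflection.
Qed.

Lemma vertexP g h j : g \in unitmx -> h \in unitmx ->
  vertex g j = vertex h j <-> P (~: [set j])%SET (invmx g *m h).
Proof. by move=> gu hu; apply: left_cosetP => //; exact: parahoric_subgroup. Qed.

Lemma vertex_mulr g p j : g \in unitmx -> P (~: [set j])%SET p ->
  vertex (g *m p) j = vertex g j.
Proof.
move=> gu Pp; have [PJu _ _ _] := parahoric_subgroup G_simple T (~: [set j])%SET.
have pu : p \in unitmx by exact: PJu.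
by apply/esym/vertexP; rewrite ?unitmx_mul ?gu // mulKmx.
Qed.

(* The homogeneous coordinates of the points [f k]. *)
Definition frame (f : 'I_r.+1 -> 'rV[R]_r) : 'M[R]_(1 + r) :=
  \matrix_(k < r.+1) row_mx (1%:M : 'M[R]_1) (f k).

(** Up to the constant [\det (frame vx)], the determinant of the linear part of the action of [n].
    It serves as the sign of a Weyl element and is unchanged by [H], which acts trivially. *)
Definition orientation (n : 'M[K]_N) : R := \det (frame (fun k => act n (vx k))).

Lemma frame_act n : W n -> exists A : 'M[R]_(1 + r),
  (forall f, frame (fun k => act n (f k)) = frame f *m A) /\
  (forall y, row_mx (1%:M : 'M[R]_1) (act n y) = row_mx (1%:M : 'M[R]_1) y *m A).
Proof.
move=> Wn; have [A [b nE]] := bt_act_affine Wn.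
exists (block_mx (1%:M : 'M[R]_1) b 0 A).
have rowE y : row_mx (1%:M : 'M[R]_1) (act n y) =
    row_mx (1%:M : 'M[R]_1) y *m block_mx (1%:M : 'M[R]_1) b 0 A.
  by rewrite mul_row_block mulmx0 addr0 !mul1mx nE addrC.
by split=> // f; apply/row_matrixP => k; rewrite row_mul !rowK.
Qed.

Lemma frame_vx_neq0 : \det (frame vx) != 0.
Proof.
apply/negP => /det0P[v v0 hv]; case/negP: v0; apply/eqP/rowP => k; rewrite mxE.
have e : \sum_k v 0 k *: row_mx (1%:M : 'M[R]_1) (vx k) = 0.
  transitivity (v *m frame vx) => //; rewrite mulmx_sum_row.
  by apply: eq_bigr => j _; rewrite rowK.
have : row_mx (\sum_k v 0 k *: (1%:M : 'M[R]_1)) (\sum_k v 0 k *: vx k) = 0.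
  rewrite -e; elim/big_rec3 : _ => [|j a b c _ <-]; first by rewrite row_mx0.
  by rewrite scale_row_mx add_row_mx.
rewrite -row_mx0 => /eq_row_mx[e1 e2].
apply: (@bt_x_indep _ _ _ _ _ _ _ _ T (fun k => v 0 k)) => //.
move/matrixP/(_ 0 0): e1; rewrite summxE [RHS]mxE => e1; rewrite -[RHS]e1.
by apply: eq_bigr => j _; rewrite !mxE mulr1.
Qed.

Lemma orientation1 : orientation 1%:M != 0.
Proof.
rewrite /orientation (_ : frame _ = frame vx) ?frame_vx_neq0 //.
by apply/row_matrixP => k; rewrite !rowK act1.
Qed.

Lemma orientation_mulH n h : W n -> H h -> orientation (n *m h) = orientation n.
Proof.
move=> Wn Hh; congr (\det _); apply/row_matrixP => k; rewrite !rowK.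
by rewrite bt_act_mul ?(act_H _ Hh) //; case: Hh.
Qed.

Lemma row'_frame f f' j : (forall k, k != j -> f k = f' k) ->
  row' j (frame f) = row' j (frame f').
Proof.
move=> h; apply/row_matrixP => k; rewrite !row_rowsub !rowK h //.
by rewrite eq_sym neq_lift.
Qed.

(* The midpoint of [vx j] and its image by the reflection [s j] lies in the wall
   spanned by the other vertices, since otherwise [s j] would fix a frame. *)
Lemma orientation_mul_s n j : W n -> orientation (n *m s j) = - orientation n.
Proof.
move=> Wn; have Ws := sW T j.
pose y := 2^-1 *: vx j + 2^-1 *: act (s j) (vx j).
pose f k := if k == j then y else vx k.
have half : 2^-1 + 2^-1 = 1 :> R by field.
have ss y' : act (s j) (act (s j) y') = y'.
  by rewrite -bt_act_mul //; apply: act_H; exact: ss_H.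
have act_mid m u v : W m ->
    act m (2^-1 *: u + 2^-1 *: v) = 2^-1 *: act m u + 2^-1 *: act m v.
  move=> Wm; have [A [b mE]] := bt_act_affine Wm.
  rewrite !mE mulmxDl -!scalemxAl !scalerDr.
  by rewrite addrACA -[in RHS](scalerDl b) half scale1r.
have f_fix k : act (s j) (f k) = f k.
  rewrite /f; case: eqP => [_|/eqP kj]; last exact: bt_s_reflection.
  by rewrite /y act_mid // ss addrC.
have f_det : \det (frame f) = 0.
  apply/eqP; apply: contrapT => /negP fdet.
  have fu : frame f \in unitmx by rewrite unitmxE unitfE.
  have [A [fA rA]] := frame_act Ws.
  have A1 : A = 1%:M.
    have : frame f *m A = frame f.
      by rewrite -fA; apply/row_matrixP => k; rewrite !rowK f_fix.
    by move=> /(congr1 (mulmx (invmx (frame f)))); rewrite mulKmx // mulVmx.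
  have [nB _] := bt_s_order2 T j; apply: nB; apply: act_fix_B => // k.
  by have := rA (vx k); rewrite A1 mulmx1 => /eq_row_mx[].
have row_mid (u v : 'rV[R]_r) : row_mx (1%:M : 'M[R]_1) (2^-1 *: u + 2^-1 *: v) =
    2^-1 *: row_mx 1%:M u + 2^-1 *: row_mx 1%:M v.
  by rewrite !scale_row_mx add_row_mx -scalerDl half scale1r.
have [A [fA _]] := frame_act Wn.
(* The frames of [n] and [n *m s j] differ only in row [j]; averaging that row gives the image of
   the degenerate frame [f]. *)
have : \det (frame (fun k => act n (f k))) =
    2^-1 * orientation n + 2^-1 * orientation (n *m s j).
  apply: (@determinant_multilinear _ _ _ _ _ j).
  - rewrite !rowK /f eqxx /y bt_act_mul // act_mid //; exact: row_mid.
  - by apply: row'_frame => k /negPf kj; rewrite /f kj.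
  - apply: row'_frame => k kj; rewrite /f (negPf kj) bt_act_mul // bt_s_reflection //.
rewrite fA det_mulmx f_det mul0r => /esym/eqP.
by rewrite -mulrDr mulf_eq0 invr_eq0 pnatr_eq0 /= addr_eq0 => /eqP ->; rewrite opprK.
Qed.

End Apartment.

(* [compact_cover] is only stated for pointed spaces. *)
Lemma compact_open_cover (X : topologicalType) (I : Type) (A : set X) (D : set I)
    (f : I -> set X) : compact A -> (forall i, D i -> open (f i)) ->
  A `<=` \bigcup_(i in D) f i ->
  exists E : set I, [/\ finite_set E, E `<=` D & A `<=` \bigcup_(i in E) f i].
Proof.
move=> /compact_near_coveringP Acov fo AD.
(* What holds eventually along this filter holds for some finite subfamily of [D]. *)
pose F : set_system (set I) := [set Q | exists2 D0, finite_set D0 /\ D0 `<=` D &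
  forall E, D0 `<=` E -> Q E].
have FF : Filter F.
  split.
  - by exists set0 => //; split; [exact: finite_set0 | exact: sub0set].
  - move=> P Q [D1 [D1f D1D] PD1] [D2 [D2f D2D] QD2]; exists (D1 `|` D2).
      by split; [rewrite finite_setU | rewrite subUset].
    by move=> E; rewrite subUset => -[D1E D2E]; split; [exact: PD1 | exact: QD2].
  - by move=> P Q PQ [D0 hD0 PD0]; exists D0 => // E /PD0 /PQ.
have [|D0 [D0f D0D] /(_ D0 (@subset_refl _ _)) AD0] :=
    Acov _ F (fun E x => (\bigcup_(i in E) f i) x) FF; last by exists D0.
move=> x /AD[i Di fix_]; exists (f i, [set E | E i]).
  split; first by apply: open_nbhs_nbhs; split => //; exact: fo.
  by exists [set i] => [|E]; [split; [exact: finite_set1 | move=> _ ->] | exact].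
by move=> [x' E] /= [fx' Ei]; exists i.
Qed.

(** * Continuity of matrix multiplication *)

Section Topology.
Variables (R : realType) (K : TopologicalField.type) (nu : K -> R).
Hypothesis nuP : nonarchimedean_abs nu.
Variable N : nat.

Lemma nu_sum_lt (I : finType) (F : I -> K) (e : R) : 0 < e ->
  (forall k, nu (F k) < e) -> nu (\sum_k F k) < e.
Proof.
have [[nu0 nu_eq0 nuM nuD] _ _] := nuP.
move=> e0 Fe; elim/big_ind : _ => [|x y hx hy|k _]; last exact: Fe.
  by rewrite (nu_eq0 0).2.
by apply: le_lt_trans (nuD x y) _; rewrite gt_max hx.
Qed.

(** A [TopologicalField] only joins a topology and a field structure; continuity comes from [nu]. By
    the ultrametric inequality, a perturbation of the entries by less than [d / (C * C)] changes
    those of the product by less than [d], where [C] bounds the entries of [P] and [Q]. *)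
Lemma open_mulmx_preimage (P Q : 'M[K]_N) (U : set 'M[K]_N) :
  open U -> open [set y | U (P *m y *m Q)].
Proof.
have [[nu0 nu_eq0 nuM nuD] _ nuT] := nuP.
rewrite !openE => oU y /= /oU [E /= nE EU].
have /choice[e eP] : forall ij : 'I_N * 'I_N, exists e : R, 0 < e /\
    forall z, nu (z - (P *m y *m Q) ij.1 ij.2) < e -> E ij.1 ij.2 z.
  by move=> [i j]; have /nuT[e e0 he] := nE i j; exists e.
have sum_nu_ge0 (M : 'M[K]_N) : 0 <= \sum_i \sum_j nu (M i j).
  by apply: sumr_ge0 => i _; apply: sumr_ge0.
have le_sum_nu (M : 'M[K]_N) i j : nu (M i j) <= \sum_i \sum_j nu (M i j).
  rewrite (bigD1 i) //= (bigD1 j) //= -addrA lerDl addr_ge0 ?sumr_ge0 // => k _.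
  exact: sumr_ge0.
pose C := \sum_i \sum_j nu (P i j) + \sum_i \sum_j nu (Q i j) + 1.
have C_gt0 : 0 < C.
  by rewrite ltr_wpDl // addr_ge0 // ?sum_nu_ge0.
have PC i j : nu (P i j) < C.
  by rewrite ltr_pwDr // ler_wpDr.
have QC i j : nu (Q i j) < C.
  by rewrite ltr_pwDr // ler_wpDl.
pose d := \big[Num.min/1]_ij e ij.
have d_gt0 : 0 < d.
  rewrite /d; elim/big_ind : _ => // [a b a0 b0|ij _]; first by rewrite lt_min a0.
  by case: (eP ij).
have de ij : d <= e ij by apply: bigmin_le_cond.
exists (fun i j => [set z | nu (z - y i j) < d / (C * C)]) => [i j|z hz] /=.
  by apply/nuT; exists (d / (C * C)) => //; rewrite divr_gt0 ?mulr_gt0.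
apply: EU => i j /=; apply: (eP (i, j)).2 => /=; apply: lt_le_trans (de (i, j)).
have -> : (P *m z *m Q) i j - (P *m y *m Q) i j =
    \sum_k (\sum_l P i l * (z l k - y l k)) * Q k j.
  rewrite !mxE -sumrB; apply: eq_bigr => k _; rewrite !mxE -mulrBl -sumrB; congr (_ * _).
  by apply: eq_bigr => l _; rewrite mulrBr.
apply: nu_sum_lt => // k; rewrite nuM.
have h : nu (\sum_l P i l * (z l k - y l k)) < d / C.
  apply: nu_sum_lt => [|l]; first exact: divr_gt0.
  rewrite nuM; apply: le_lt_trans (_ : C * nu (z l k - y l k) < _).
    by apply: ler_wpM2r => //; exact/ltW/PC.
  rewrite -(@ltr_pM2l _ C^-1) ?invr_gt0 // mulKf ?gt_eqF //.
  by have := hz l k; rewrite /= invfM mulrA mulrC.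
apply: le_lt_trans (_ : nu (\sum_l P i l * (z l k - y l k)) * C < _).
  by apply: ler_wpM2l => //; exact/ltW/QC.
by rewrite -ltr_pdivlMr.
Qed.
End Topology.

(** * Finite index of the Iwahori subgroup in the maximal parahoric subgroups *)

Section Finiteness.
Variables (R : realType) (K : TopologicalField.type) (nu : K -> R).
Hypothesis nuP : nonarchimedean_abs nu.
Variables (L : closedFieldType) (iota : {rmorphism K -> L}) (N : nat).
Variables (G : set 'M[L]_N) (r : nat).
Hypothesis G_simple : almost_simple iota G.
Variable T : bruhat_tits_system nu iota G r.

Local Notation Gp := (Gplus iota G).
Local Notation B := (bt_B T).
Local Notation W := (bt_N T).
Local Notation act := (bt_act T).

Lemma B_Gp b : B b -> Gp b.
Proof. by move/bt_B_sub. Qed.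

Lemma B_finite_cover n : Gp n -> exists D : set 'M[K]_N,
  [/\ finite_set D, D `<=` B &
      forall b, B b -> exists2 d, D d & B (invmx (d *m n) *m (b *m n))].
Proof.
move=> Gn; have nu' := Gp_unit G_simple Gn; have [_ G1 GM GV] := Gplus_subgroup G_simple.
have [U oU BU] := bt_B_open T.
have [|b Bb|D [Dfin DB Dcov]] := @compact_open_cover _ _ _ B
  (fun d => [set b | U (invmx (d *m n) *m b *m n)]) (@bt_B_compact _ _ _ _ _ _ _ _ T).
- by move=> d _; exact: (open_mulmx_preimage nuP).
- exists b => //=; rewrite -mulmxA mulVmx.
    by have := B1 T; rewrite BU => -[].
  by rewrite unitmx_mul nu' (B_unit Bb).
exists D; split => // b Bb.
have [d dD /= Ud] := Dcov b Bb; exists d => //.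
have Bd : B d := DB _ dD.
rewrite BU; split; last by rewrite mulmxA.
by apply: (GM); [apply: (GV); apply: (GM) | apply: (GM)] => //; exact: B_Gp.
Qed.

(** The parahoric is a union of double cosets of Weyl elements fixing [bt_x T j]. By discreteness
    these act in finitely many ways, and the action determines the element up to right
    multiplication by [B], so [B_finite_cover] is needed for one representative per action. *)
Lemma parahoric_finite_index j : exists F : set 'M[K]_N,
  [/\ finite_set F, F `<=` Gp &
      forall p, parahoric T (~: [set j])%SET p -> exists2 f, F f & B (invmx f *m p)].
Proof.
have [_ _ GM _] := Gplus_subgroup G_simple.
pose y := bt_x T j.
pose M := \sum_k `|y 0 k|.
pose A := [set act n | n in W `&` [set n | act n y = y]].
have Afin : finite_set A.
  apply: sub_finite_set (bt_act_discrete T y M) => _ [n [Wn ny] <-].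
  exists n => //; split => //= k; rewrite ny /M (bigD1 k) //=.
  by rewrite lerDl sumr_ge0.
pose rep (phi : 'rV[R]_r -> 'rV[R]_r) := xget 1%:M [set n | W n /\ act n = phi].
have repP phi : A phi -> W (rep phi) /\ act (rep phi) = phi.
  move=> [n [Wn _] nphi].
  by apply: (@xgetPex _ 1%:M [set n | W n /\ act n = phi]); exists n.
have /choice[D DP] : forall n, exists D : set 'M[K]_N, Gp n ->
  [/\ finite_set D, D `<=` B &
      forall b, B b -> exists2 d, D d & B (invmx (d *m n) *m (b *m n))].
  move=> n; have [Gn|nGn] := pselect (Gp n); last by exists set0.
  by have [D hD] := B_finite_cover Gn; exists D.
exists (\bigcup_(phi in A) [set d *m rep phi | d in D (rep phi)]); split.
- apply: bigcup_finite => // phi /repP[Wn _]; apply: finite_image.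
  by case: (DP _ (W_Gp Wn)).
- move=> _ [phi /repP[Wn _] [d dD <-]]; have [_ DB _] := DP _ (W_Gp Wn).
  by apply: (GM); [apply: B_Gp; exact: DB | exact: (W_Gp Wn)].
move=> p /(parahoric_double_coset G_simple)[n nJ [b [c [Bb Bc ->]]]].
have Wn := words_W G_simple nJ.
have Aphi : A (act n).
  exists n => //; split => //=; apply: (act_words G_simple _ nJ).
  by rewrite /= !inE eqxx.
have [Wm mE] := repP _ Aphi; set m := rep _ in Wm mE.
have [_ DB Dcov] := DP _ (W_Gp Wm).
have [d dD Bd] := Dcov b Bb; exists (d *m m); first by exists (act n) => //; exists d.
have Bmn : B (invmx m *m n).
  apply: act_fix_B; first by apply: (WM G_simple) => //; exact: WV.
  move=> k; rewrite bt_act_mul //; last exact: (WV G_simple).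
  by rewrite -mE actVK.
have -> : invmx (d *m m) *m (b *m n *m c) =
    invmx (d *m m) *m (b *m m) *m (invmx m *m n) *m c.
  by rewrite !mulmxA mulmxK //; exact: (W_unit G_simple Wm).
by apply: BM => //; apply: BM.
Qed.

End Finiteness.

(** * The link of a vertex *)

Section Link.
Variables (R : realType) (K : TopologicalField.type) (nu : K -> R).
Hypothesis nuP : nonarchimedean_abs nu.
Variables (L : closedFieldType) (iota : {rmorphism K -> L}) (N : nat).
Variables (G : set 'M[L]_N) (l : nat).
Hypothesis G_simple : almost_simple iota G.
Variable T : bruhat_tits_system nu iota G l.+1.
Variables (g0 : 'M[K]_N) (j0 : 'I_l.+2).
Hypothesis Gg0 : Gplus iota G g0.

Local Notation Gp := (Gplus iota G).
Local Notation B := (bt_B T).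
Local Notation s := (bt_s T).
Local Notation P J := (parahoric T J).
Local Notation vertex := (vertex T).
Local Notation x := (vertex g0 j0).
Local Notation X := (link (building T) x).

Lemma vertex_inj g : Gp g -> injective (vertex g).
Proof.
move=> Gg j k; apply: (vertex_type_inj G_simple); exact: (Gp_unit G_simple Gg).
Qed.

(** Types in the link are renumbered by [lift j0], which skips the type of [x]. *)
Definition face (g : 'M[K]_N) (J : {set 'I_l.+1}) : {fset set 'M[K]_N} :=
  [fset vertex g (lift j0 a) | a in J]%fset.

(** By [vertex_type_inj], a chamber containing [x] has it as its vertex of type [j0]; removing [x]
    therefore removes that type. *)
Lemma linkP t : X t <->
  exists g J, [/\ Gp g, vertex g j0 = x, J != finset.set0 & t = face g J].
Proof.
split=> [[t0 xt [g [J' [Gg J'0 e]]]]|[g [J [Gg gx J0 ->]]]].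
  have [j1 j1J xE] : exists2 j1, j1 \in J' & x = vertex g j1.
    have : x \in (x |` t)%fset by rewrite !inE eqxx.
    by rewrite e => /imfsetP[j1 /= j1J ->]; exists j1.
  have j01 : j0 = j1.
    by apply: (vertex_type_inj G_simple _ _ xE); exact: (Gp_unit G_simple).
  rewrite -j01 in xE j1J; pose J := [set a | lift j0 a \in J']%SET.
  have tE : t = face g J.
    apply/fsetP => v; apply/idP/imfsetP => [vt|[a /=]].
      have : v \in (x |` t)%fset by rewrite !inE vt orbT.
      rewrite e => /imfsetP[j /= jJ vE]; case: (unliftP j0 j) => [a ja|jj0].
        by exists a; rewrite /= ?inE -?ja.
      by move: xt; rewrite xE -jj0 -[vertex g j]vE vt.
    rewrite inE => aJ vE.
    have : v \in (x |` t)%fset by rewrite e; apply/imfsetP; exists (lift j0 a).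
    rewrite !inE => /orP[/eqP vx|//].
    have /eqP := vertex_inj Gg (etrans (esym vE) (etrans vx xE)).
    by rewrite eq_sym (negPf (neq_lift _ _)).
  exists g, J; split => //.
  apply: contraNneq t0 => J0; rewrite tE J0 /face; apply/eqP/fsetP => v.
  by rewrite !inE; apply/imfsetP => -[a /=]; rewrite inE.
split.
- have /set0Pn[a aJ] := J0; apply/fset0Pn; exists (vertex g (lift j0 a)).
  by apply/imfsetP; exists a.
- apply/negP => /imfsetP[a /= aJ]; rewrite -gx => /(vertex_inj Gg) /eqP.
  by rewrite (negPf (neq_lift _ _)).
- exists g, (j0 |: [set lift j0 a | a in J])%SET; split => //.
    by apply/set0Pn; exists j0; rewrite !inE eqxx.
  apply/fsetP => v; rewrite !inE; apply/orP/imfsetP => [[/eqP ->|/imfsetP[a /= aJ ->]]|[j /=]].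
  + by exists j0; rewrite /= ?inE ?eqxx.
  + by exists (lift j0 a) => //=; rewrite !inE imset_f ?orbT.
  + rewrite !inE => /orP[/eqP -> ->|/imsetP[a aJ ->] ->]; first by left; rewrite -gx.
    by right; apply/imfsetP; exists a.
Qed.

Definition vertex_type (v : set 'M[K]_N) : 'I_l.+1 :=
  xget ord0 [set a | exists2 g, Gp g & v = vertex g (lift j0 a)].

Lemma vertex_typeE g a : Gp g -> vertex_type (vertex g (lift j0 a)) = a.
Proof.
move=> Gg; apply: xget_unique; first by exists g.
move=> b [h Gh /(vertex_type_inj G_simple)]; move=> /(_ (Gp_unit G_simple Gg)).
by move=> /(_ (Gp_unit G_simple Gh)) /lift_inj.
Qed.

Lemma face_sub g (J J' : {set 'I_l.+1}) : J \subset J' -> (face g J `<=` face g J')%fset.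
Proof.
move=> /fintype.subsetP JJ; apply/fsubsetP => v /imfsetP[a /= aJ ->].
by apply/imfsetP; exists a => //=; exact: JJ.
Qed.

Lemma link_sub (t' t : {fset set 'M[K]_N}) : X t -> (t' `<=` t)%fset -> t' != fset0 -> X t'.
Proof.
move=> /linkP[g [J [Gg gx J0 ->]]] /fsubsetP t'J t'0; apply/linkP.
pose J' := [set a | vertex g (lift j0 a) \in t']%SET.
have tE : t' = face g J'.
  apply/fsetP => v; apply/idP/imfsetP => [vt|[a /=]]; last by rewrite inE => ? ->.
  by have /imfsetP[a /= aJ vE] := t'J v vt; exists a; rewrite //= inE -vE.
exists g, J'; split => //.
have /fset0Pn[v vt] := t'0; have := vt; rewrite tE => /imfsetP[a /= aJ _].
by apply/set0Pn; exists a.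
Qed.

Lemma link_pure t : X t -> exists sg, [/\ X sg, (t `<=` sg)%fset & #|` sg| = l.+1].
Proof.
move=> /linkP[g [J [Gg gx J0 ->]]]; exists (face g finset.setT); split.
- apply/linkP; exists g, finset.setT; split => //.
  by apply/set0Pn; exists ord0; rewrite inE.
- exact/face_sub/finset.subsetT.
- rewrite card_imfset /= -?cardE ?cardsT ?card_ord //.
  by move=> a b /(vertex_inj Gg) /lift_inj.
Qed.

Lemma link_types t : X t -> {in t &, injective vertex_type}.
Proof.
move=> /linkP[g [J [Gg gx J0 ->]]] _ _ /imfsetP[a _ ->] /imfsetP[b _ ->].
by rewrite !vertex_typeE // => ->.
Qed.

Lemma link_neq0 : X !=set0.
Proof.
exists (face g0 finset.setT); apply/linkP; exists g0, finset.setT; split => //.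
by apply/set0Pn; exists ord0; rewrite inE.
Qed.

(** A chamber through [x] is [g0 p B] with [p] in the parahoric of type [~: [set j0]], and its faces
    depend on [p] only modulo [B]. *)
Lemma link_finite : finite_set X.
Proof.
have [F [Ffin FG Fcov]] := parahoric_finite_index nuP G_simple T j0.
apply: (sub_finite_set (B :=
  (fun fJ : 'M[K]_N * {set 'I_l.+1} => face (g0 *m fJ.1) fJ.2) @` (F `*` setT))); last first.
  apply: finite_image; apply: finite_setX => //; exact: finite_finset.
move=> t /linkP[g [J [Gg gx J0 ->]]].
have g0u := Gp_unit G_simple Gg0; have gu := Gp_unit G_simple Gg.
have [f fF Bf] := Fcov _ ((vertexP G_simple T j0 g0u gu).1 (esym gx)).
exists (f, J) => //=; rewrite /face; apply: eq_imfset => //= a.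
have fu := Gp_unit G_simple (FG _ fF).
apply/(vertexP G_simple T); rewrite ?unitmx_mul ?g0u //.
by apply: parahoric_B => //; rewrite (invmxM g0u fu) -mulmxA.
Qed.

(** * The cycle formed by the Weyl group images of a face *)

Section Cycle.
Variables (i : nat) (i_lt : (i < l)%N).

(** The face has the types [0, ..., i] of the link, and [i < l] leaves type [l] for the apex. [KJ]
    is the same set of types numbered in the building; it contains neither [j0] nor [cone_type]. *)
Let J (a : 'I_i.+1) : 'I_l.+1 := widen_ord (ltnW i_lt : (i.+1 <= l.+1)%N) a.
Let typ a := lift j0 (J a).
Let KJ : {set 'I_l.+2} := [set typ a | a in 'I_i.+1]%SET.
Let cone_type := lift j0 (@ord_max l).

Local Notation words J := (words T J).
Local Notation wj := (words (mem KJ)).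

Let J_inj : injective J.
Proof. by move=> a b /(congr1 val) /= e; apply: val_inj. Qed.

Let typ_KJ a : typ a \in KJ. Proof. exact: imset_f. Qed.

Let typ_inj : injective typ. Proof. by move=> a b /lift_inj /J_inj. Qed.

Let j0_KJ : j0 \notin KJ.
Proof. by apply/imsetP => -[a _ /eqP]; rewrite (negPf (neq_lift _ _)). Qed.

Let cone_KJ : cone_type \notin KJ.
Proof.
apply/imsetP => -[a _ /lift_inj /(congr1 val) /= e].
by have := leq_trans (ltn_ord a) i_lt; rewrite -e ltnn.
Qed.

Let wj_parahoric n j : j \notin KJ -> wj n -> P (~: [set j])%SET n.
Proof.
move=> jK; apply: (parahoric_words G_simple) => m mK.
by rewrite !inE; apply: contraNneq jK => <-.
Qed.

Let wj_Gp n : wj n -> Gp n. Proof. by move=> /(words_W G_simple) /W_Gp. Qed.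

Let wj_unit n : wj n -> n \in unitmx. Proof. by move=> /wj_Gp /(Gp_unit G_simple). Qed.

Let GpM g h : Gp g -> Gp h -> Gp (g *m h).
Proof. by have [_ _ m _] := Gplus_subgroup G_simple; exact: m. Qed.

Let g0u : g0 \in unitmx. Proof. exact: (Gp_unit G_simple Gg0). Qed.

Let g0wj_unit n : wj n -> g0 *m n \in unitmx.
Proof. by move=> /wj_unit nu'; rewrite unitmx_mul g0u. Qed.

Let tup n : i.+1.-tuple (set 'M[K]_N) := [tuple vertex (g0 *m n) (typ a) | a < i.+1].

Let Z : set (i.+1.-tuple (set 'M[K]_N)) := [set t | exists2 n, wj n & t = tup n].

Let rep t := xget 1%:M [set n | wj n /\ t = tup n].

Let repP n : wj n -> wj (rep (tup n)) /\ tup n = tup (rep (tup n)).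
Proof.
move=> nw; apply: (@xgetPex _ 1%:M [set m | wj m /\ tup n = tup m]).
by exists n.
Qed.

(* An element of the finite Weyl group that fixes the face of type [KJ] of the
   fundamental chamber fixes all of its vertices. *)
Let tup_eqP n m : wj n -> wj m -> tup n = tup m ->
  exists2 h, (bt_B T `&` bt_N T) h & m = n *m h.
Proof.
move=> nw mw e; have Wn := words_W G_simple nw; have Wm := words_W G_simple mw.
have nu' := wj_unit nw; have mu := wj_unit mw.
have Wh : bt_N T (invmx n *m m) by apply: (WM G_simple) => //; exact: (WV G_simple).
exists (invmx n *m m); last by rewrite mulmxA mulmxV ?mul1mx.
split=> //; apply: act_fix_B => // k.
have [/imsetP[a _ ->]|kK] := boolP (k \in KJ).
  have : vertex (g0 *m n) (typ a) = vertex (g0 *m m) (typ a).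
    by move: e => /(congr1 (fun t => tnth t a)); rewrite !tnth_mktuple.
  move=> /(vertexP G_simple T _ (g0wj_unit nw) (g0wj_unit mw)).
  rewrite (invmxM g0u nu') -mulmxA mulKmx // => Ph.
  by apply: (act_parahoric G_simple _ Wh Ph); rewrite !inE eqxx.
rewrite bt_act_mul //; last exact: (WV G_simple).
rewrite (act_words G_simple kK mw) -{1}(act_words G_simple kK nw).
by rewrite actVK.
Qed.

Let tup_mulH n h : wj n -> (bt_B T `&` bt_N T) h -> tup (n *m h) = tup n.
Proof.
move=> nw [Bh _]; apply: eq_from_tnth => a; rewrite !tnth_mktuple mulmxA.
by apply: (vertex_mulr G_simple) => //; [exact: g0wj_unit | exact: parahoric_B].
Qed.

(** A tuple determines its Weyl element only modulo [H], to which [orientation] and [tup] are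
    insensitive. In [phi] the reflection multiplies on the right, which passes to the adjacent
    chamber and moves a single vertex. *)
Let eps t := orientation T (rep t).
Let phi (a : 'I_i.+1) t := tup (rep t *m s (typ a)).

Let eps_tup n : wj n -> eps (tup n) = orientation T n.
Proof.
move=> nw; have [rw e] := repP nw; have [h Hh] := tup_eqP nw rw e.
by rewrite /eps => ->; apply: orientation_mulH => //; exact: (words_W G_simple nw).
Qed.

Let phi_tup a n : wj n -> phi a (tup n) = tup (n *m s (typ a)).
Proof.
move=> nw; have [rw e] := repP nw; have [h Hh] := tup_eqP nw rw e.
rewrite /phi => ->; have Ws := sW T (typ a); have su := s_unit G_simple T (typ a).
have -> : n *m h *m s (typ a) = (n *m s (typ a)) *m (invmx (s (typ a)) *m h *m s (typ a)).
  by rewrite !mulmxA mulmxK.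
apply: tup_mulH; first by apply: (words_muls G_simple) => //; exact: typ_KJ.
exact: (H_conjV G_simple).
Qed.

Let wj_s a n : wj n -> wj (n *m s (typ a)).
Proof. by move=> nw; apply: (words_muls G_simple) => //; exact: typ_KJ. Qed.

Lemma link_eigenvalue_bounds : exists M m : R,
  [/\ max_eigenvalue X i M, min_nonzero_eigenvalue X i m,
      M = l.+1%:R & m <= (l - i)%N%:R].
Proof.
apply: (@eigenvalue_bounds_of_cycle R _ X l vertex_type link_finite link_sub link_pure
  link_types link_neq0 i J Z eps phi (vertex g0 cone_type) (tup 1%:M) i_lt J_inj).
- move=> _ [n nw ->] a; rewrite tnth_mktuple; apply: vertex_typeE.
  by apply: GpM => //; exact: wj_Gp.
(* A word [n] in [KJ] lies in the parahorics attached to [j0] and [cone_type], so the chamber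
   [g0 *m n] contains [x] and the apex along with [tup n]. *)
- move=> _ [n nw ->]; apply/linkP.
  exists (g0 *m n), (ord_max |: [set J a | a in 'I_i.+1])%SET; split.
  + by apply: GpM => //; exact: wj_Gp.
  + by apply: (vertex_mulr G_simple) => //; exact: wj_parahoric.
  + by apply/set0Pn; exists ord_max; rewrite !inE eqxx.
  have coneE : vertex g0 cone_type = vertex (g0 *m n) cone_type.
    by apply/esym/(vertex_mulr G_simple) => //; exact: wj_parahoric.
  apply/fsetP => v; rewrite !inE; apply/orP/imfsetP => /=.
    case=> [/eqP ->|/(@tnthP _ _ (tup n))[a ->]].
      by exists ord_max; rewrite ?inE ?eqxx.
    exists (J a); last by rewrite tnth_mktuple.
    by rewrite !inE imset_f ?orbT.
  move=> [b]; rewrite !inE => /orP[/eqP -> ->|/imsetP[a _ ->] ->].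
    by left; rewrite coneE.
  by right; apply/(@tnthP _ _ (tup n)); exists a; rewrite tnth_mktuple.
- by move=> a _ [n nw ->]; rewrite phi_tup //; exists (n *m s (typ a)) => //; exact: wj_s.
- move=> a _ [n nw ->]; rewrite !phi_tup //; last exact: wj_s.
  rewrite -mulmxA; apply: tup_mulH => //; exact: (ss_H G_simple).
(* The remaining entries have types other than [typ a], so [s (typ a)] belongs to their parahorics
   and leaves the cosets unchanged. *)
- move=> a _ [n nw ->]; rewrite phi_tup //; apply: eq_from_tnth => b.
  rewrite !tnth_mktuple mulmxA.
  apply: (vertex_mulr G_simple); first exact: g0wj_unit.
  by apply: parahoric_s => //; rewrite !inE (inj_eq typ_inj) neq_lift.
- move=> a _ [n nw ->]; rewrite phi_tup // !eps_tup //; last exact: wj_s.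
  by apply: (orientation_mul_s G_simple); exact: (words_W G_simple nw).
- by exists 1%:M => //; exact: (words1 G_simple).
- by rewrite eps_tup ?orientation1 //; exact: (words1 G_simple).
Qed.

End Cycle.

End Link.

Theorem theorem1p1 (R : realType)
    (K : TopologicalField.type) (nu : K -> R) (q : nat)
    (hnu : nonarchimedean_abs nu)
    (hK : locally_compact [set: K])
    (hq : residue_order nu q)
    (L : closedFieldType) (iota : {rmorphism K -> L})
    (hL : integralRange iota)
    (N : nat) (G : set 'M[L]_N) (l : nat)
    (hG : almost_simple iota G)
    (hrank : has_rank iota G l.+1)
    (T : bruhat_tits_system nu iota G l.+1)
    (x : set 'M[K]_N) (hx : building T [fset x]%fset)
    (i : nat) (hi : (i < l)%N) :
  exists M m : R,
    [/\ max_eigenvalue (link (building T) x) i M,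
        min_nonzero_eigenvalue (link (building T) x) i m,
        M = l.+1%:R & m <= (l - i)%N%:R].
Proof.
have [g [J [Gg _ e]]] := hx.
have : x \in [fset x]%fset by rewrite inE.
rewrite e => /imfsetP[j _ ->].
exact: (link_eigenvalue_bounds hnu hG T j Gg hi).
Qed.
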